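(* Let $\mathbb K=\mathbb R$ or $\mathbb C$. The Lie algebras $\mathfrak{saff}(2)=\mathfrak{sl}(2,\mathbb K)\ltimes\mathbb K^2$ of volume preserving affine transformations of $\mathbb K^2$ and $\mathfrak{e}(3)=\mathfrak{so}(3)\ltimes\mathbb R^3$ of Euclidean transformations of $\mathbb R^3$ are degenerate formally and analytically, and (over $\mathbb R$) also smoothly. That is, for each of these Lie algebras and each of these categories there exists a Poisson structure of that category, vanishing at a point and with linear part corresponding to the given Lie algebra, which is not linearizable in that category.
   Context: Let $\Pi$ be a formal, analytic or smooth Poisson structure vanishing at $0\in\mathbb K^N$ (analytic means real-analytic resp. holomorphic near $0$; formal means with coefficients that are formal power series at $0$; smooth means $C^\infty$ near $0$, with $\mathbb K=\mathbb R$). In coordinates $(z_1,\dots,z_N)$ centered at $0$, $\{z_i,z_j\}=\sum_k c_{ij}^k z_k+\cdots$; the linear part $\Pi^{(1)}$ is the linear Poisson structure $\{z_i,z_j\}=\sum_k c_{ij}^k z_k$. The $c_{ij}^k$ are the structure constants of an $N$-dimensional Lie algebra $\mathfrak g$ (well defined up to isomorphism), and one says that the linear part corresponds to $\mathfrak g$. $\Pi$ is formally (resp. analytically, smoothly) linearizable if there is a formal (resp. local analytic, local smooth) change of coordinates at $0$ transforming $\Pi$ into $\Pi^{(1)}$. A Lie algebra $\mathfrak g$ is formally (resp. analytically, smoothly) nondegenerate if every formal (resp. analytic, smooth) Poisson structure vanishing at a point with linear part corresponding to $\mathfrak g$ is formally (resp. analytically, smoothly) linearizable; otherwise it is degenerate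 in that sense. In the semidirect products, $\mathfrak{sl}(2,\mathbb K)$ and $\mathfrak{so}(3)$ act on $\mathbb K^2$ and $\mathbb R^3$ by their standard representations. *)

(* Defs.v *)
From HB Require Import structures.
From mathcomp Require Import all_boot all_order all_algebra.
From mathcomp Require Import all_classical all_reals all_analysis.
From mathcomp Require Export complex.
From mathcomp Require Import ring.

Set Implicit Arguments.
Unset Strict Implicit.
Unset Printing Implicit Defensive.

Import Order.TTheory GRing.Theory Num.Theory.
Import numFieldNormedType.Exports.

Local Open Scope classical_set_scope.
Local Open Scope ring_scope.

Section LieAlgebras.
Variable K : fieldType.

Record lieAlgebra := LieAlgebra {
  lie_space :> vectType K;
  lie_bracket : lie_space -> lie_space -> lie_space;
  lie_linearl : forall y, linear (lie_bracket^~ y);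
  lie_linearr : forall x, linear (lie_bracket x);
  lie_alt : forall x, lie_bracket x x = 0;
  lie_jacobi : forall x y z,
    lie_bracket x (lie_bracket y z) + lie_bracket y (lie_bracket z x)
      + lie_bracket z (lie_bracket x y) = 0
}.

Definition structure_constants (g : lieAlgebra) (N : nat)
    (c : 'I_N -> 'I_N -> 'I_N -> K) : Prop :=
  exists e : N.-tuple g, basis_of fullv e /\
    forall i j, lie_bracket (tnth e i) (tnth e j)
                = \sum_(k < N) c i j k *: tnth e k.

Definition commutator n (A B : 'M[K]_n) : 'M[K]_n := A *m B - B *m A.

Section Semidirect.
Variables (n : nat) (h : {vspace 'M[K]_n}).
Hypothesis hC : forall A B, A \in h -> B \in h -> commutator A B \in h.

(* (A, v) stands for the infinitesimal affine map x |-> A x + v of K^n. *)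
Definition semidirect_bracket (x y : subvs_of h * 'cV[K]_n)
    : subvs_of h * 'cV[K]_n :=
  (vsproj h (commutator (vsval x.1) (vsval y.1)),
   vsval x.1 *m y.2 - vsval y.1 *m x.2).

Fact commutator_linearr (A : 'M[K]_n) : linear (commutator A).
Proof.
move=> a B C; rewrite /commutator mulmxDr mulmxDl -scalemxAl -scalemxAr.
by rewrite scalerBr opprD addrACA.
Qed.

Fact semidirect_linearr x : linear (semidirect_bracket x).
Proof.
move=> a y z; apply/eqP/andP; split; apply/eqP.
- by rewrite [LHS]/= linearP commutator_linearr linearP.
- rewrite [LHS]/= linearP /= mulmxDl -scalemxAl.
  by rewrite scalerBr opprD addrACA.
Qed.

Fact semidirect_alt x : semidirect_bracket x x = 0.
Proof. by rewrite /semidirect_bracket /commutator !subrr linear0. Qed.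

Fact semidirect_anti x y : semidirect_bracket x y = - semidirect_bracket y x.
Proof.
apply/eqP/andP; split; apply/eqP; last by rewrite /= opprB.
by rewrite /= -linearN /commutator opprB.
Qed.

Fact semidirect_linearl y : linear (semidirect_bracket^~ y).
Proof.
move=> a x z /=; rewrite !(semidirect_anti _ y) semidirect_linearr.
by rewrite opprD scalerN.
Qed.

Fact commutator_jacobi (A B C : 'M[K]_n) :
  commutator A (commutator B C) + commutator B (commutator C A)
  + commutator C (commutator A B) = 0.
Proof.
rewrite /commutator !mulmxBr !mulmxBl !mulmxA.
set t1 := A *m B *m C; set t2 := A *m C *m B; set t3 := B *m C *m A.
set t4 := C *m B *m A; set t5 := B *m A *m C; set t6 := C *m A *m B.
by apply/matrixP => i j; rewrite !mxE; ring.
Qed.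

Fact semidirect_jacobi x y z :
  semidirect_bracket x (semidirect_bracket y z)
  + semidirect_bracket y (semidirect_bracket z x)
  + semidirect_bracket z (semidirect_bracket x y) = 0.
Proof.
apply/eqP/andP; split; apply/eqP.
- rewrite [LHS]/= -!linearD.
  rewrite !(vsprojK (hC _ _)) ?subvsP //.
  by rewrite commutator_jacobi linear0.
- rewrite [LHS]/= !(vsprojK (hC _ _)) ?subvsP // /commutator.
  move: (vsval x.1) (vsval y.1) (vsval z.1) => A B C.
  rewrite !mulmxBr !mulmxBl !mulmxA.
  by apply/matrixP => i j; rewrite !mxE; ring.
Qed.

Definition semidirect : lieAlgebra :=
  LieAlgebra semidirect_linearl semidirect_linearr semidirect_alt
             semidirect_jacobi.

End Semidirect.

Definition sl n : {vspace 'M[K]_n} := lker (linfun (@mxtrace K n : _ -> K^o)).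

Definition so n : {vspace 'M[K]_n} :=
  lker (linfun (fun A : 'M[K]_n => A + A^T)).

Lemma mem_sl n (A : 'M[K]_n) : (A \in sl n) = (\tr A == 0).
Proof. by rewrite memv_ker lfunE. Qed.

Lemma mem_so n (A : 'M[K]_n) : (A \in so n) = (A^T == - A).
Proof.
pose f (A : 'M[K]_n) := A + A^T.
have flin : linear f by move=> a B C; rewrite /f !linearP /= scalerDr addrACA.
pose fL : {linear _ -> _} :=
  HB.pack f (GRing.isLinear.Build K 'M[K]_n 'M[K]_n *:%R f flin).
by rewrite memv_ker (lfunE fL) /= /f addrC addr_eq0.
Qed.

Lemma sl_commutator n (A B : 'M[K]_n) :
  A \in sl n -> B \in sl n -> commutator A B \in sl n.
Proof. by rewrite !mem_sl linearB /= mxtrace_mulC subrr. Qed.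

Lemma so_commutator n (A B : 'M[K]_n) :
  A \in so n -> B \in so n -> commutator A B \in so n.
Proof.
rewrite !mem_so => /eqP At /eqP Bt.
by rewrite linearB /= !trmx_mul At Bt !mulmxN !mulNmx !opprK opprB.
Qed.

Definition saff2 : lieAlgebra := semidirect (@sl_commutator 2).
Definition e3 : lieAlgebra := semidirect (@so_commutator 3).

End LieAlgebras.

Section Formal.
Variables (K : numFieldType) (N : nat).

Definition multiindex := {ffun 'I_N -> nat}.

Definition mi0 : multiindex := [ffun=> 0%N].
Definition mi1 (k : 'I_N) : multiindex := [ffun i => (i == k) : nat].
Definition miadd (a b : multiindex) : multiindex := [ffun i => (a i + b i)%N].
Definition misub (a b : multiindex) : multiindex := [ffun i => (a i - b i)%N].

(* A formal power series in z_1, ..., z_N, given by its coefficients. *)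
Definition fps := multiindex -> K.

(* Cauchy product; the bound in 'I_ only serves to make the range finite. *)
Definition fps_mul (f g : fps) : fps := fun m =>
  \sum_(a : {ffun 'I_N -> 'I_(\sum_(j < N) m j)%N.+1}
        | [forall i, (a i <= m i)%N])
    f [ffun i => a i : nat] * g (misub m [ffun i => a i : nat]).

Definition fps_pd (f : fps) (k : 'I_N) : fps := fun m =>
  f (miadd m (mi1 k)) *+ (m k).+1.

(* The bivector with {z_i, z_j} = pi i j; the second condition is the identity
   {z_i, {z_j, z_k}} + {z_j, {z_k, z_i}} + {z_k, {z_i, z_j}} = 0. *)
Definition formal_poisson (pi : 'I_N -> 'I_N -> fps) : Prop :=
  (forall i j m, pi i j m = - pi j i m) /\
  (forall i j k m,
     \sum_(l < N) (fps_mul (pi i l) (fps_pd (pi j k) l) m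
                   + fps_mul (pi j l) (fps_pd (pi k i) l) m
                   + fps_mul (pi k l) (fps_pd (pi i j) l) m) = 0).

Definition formal_vanishing (pi : 'I_N -> 'I_N -> fps) : Prop :=
  forall i j, pi i j mi0 = 0.

Definition formal_linear_part (pi : 'I_N -> 'I_N -> fps)
    : 'I_N -> 'I_N -> 'I_N -> K :=
  fun i j k => pi i j (mi1 k).

Definition formal_coordinates (phi : 'I_N -> fps) : Prop :=
  (forall i, phi i mi0 = 0) /\
  (\matrix_(i < N, k < N) phi i (mi1 k)) \in unitmx.

(* {phi_i, phi_j} computed with pi is the linear function
   sum_k c_ij^k phi_k of the new coordinates. *)
Definition formally_linearizable (pi : 'I_N -> 'I_N -> fps) : Prop :=
  exists phi : 'I_N -> fps, formal_coordinates phi /\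
    forall i j m,
      \sum_(k < N) \sum_(l < N)
         fps_mul (pi k l) (fps_mul (fps_pd (phi i) k) (fps_pd (phi j) l)) m
      = \sum_(k < N) formal_linear_part pi i j k * phi k m.

End Formal.

Definition formally_degenerate (K : numFieldType) (g : lieAlgebra K) : Prop :=
  exists (N : nat) (pi : 'I_N -> 'I_N -> fps K N),
    [/\ formal_poisson pi, formal_vanishing pi,
        structure_constants g (formal_linear_part pi) &
        ~ formally_linearizable pi].

Section Germs.
Variables (K : numFieldType) (N : nat).
Implicit Types f : 'rV[K]_N -> K.

Definition pd f (k : 'I_N) : 'rV[K]_N -> K :=
  fun x => 'D_(delta_mx 0 k : 'rV[K]_N) f x.

Definition iter_pd f (s : seq 'I_N) : 'rV[K]_N -> K := foldl pd f s.

(* C^infinity on a neighbourhood of 0 that serves all orders at once. *)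
Definition smooth_near0 f : Prop :=
  exists U : set 'rV[K]_N, [/\ open U, U 0 &
    forall (s : seq 'I_N) x, U x ->
      {for x, continuous (iter_pd f s)} /\
      forall k : 'I_N, derivable (iter_pd f s) x (delta_mx 0 k : 'rV[K]_N)].

Definition monomial (a : multiindex N) (h : 'rV[K]_N) : K :=
  \prod_(i < N) h 0 i ^+ a i.

(* Near p, f is the sum of an absolutely convergent power series in x - p.
   Partial sums are taken over the boxes {0, ..., n-1}^N. *)
Definition analytic_at f (p : 'rV[K]_N) : Prop :=
  exists a : multiindex N -> K, \forall h \near (0 : 'rV[K]_N),
    (exists M : K, forall n : nat,
      \sum_(b : {ffun 'I_N -> 'I_n})
        `|a [ffun i => b i : nat] * monomial [ffun i => b i : nat] h| <= M) /\
    (fun n : nat => \sum_(b : {ffun 'I_N -> 'I_n})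
        a [ffun i => b i : nat] * monomial [ffun i => b i : nat] h)
      @ \oo --> f (p + h).

Definition analytic_near0 f : Prop :=
  \forall p \near (0 : 'rV[K]_N), analytic_at f p.

(* Functions on K^N represent germs at 0: only values near 0 matter. *)
Definition poisson_near0 (pi : 'I_N -> 'I_N -> 'rV[K]_N -> K) : Prop :=
  \forall x \near (0 : 'rV[K]_N),
    (forall i j, pi i j x = - pi j i x) /\
    (forall i j k,
       \sum_(l < N) (pi i l x * pd (pi j k) l x + pi j l x * pd (pi k i) l x
                     + pi k l x * pd (pi i j) l x) = 0).

Definition vanishing_at0 (pi : 'I_N -> 'I_N -> 'rV[K]_N -> K) : Prop :=
  forall i j, pi i j 0 = 0.

Definition linear_part (pi : 'I_N -> 'I_N -> 'rV[K]_N -> K)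
    : 'I_N -> 'I_N -> 'I_N -> K :=
  fun i j k => pd (pi i j) k 0.

Variable C : ('rV[K]_N -> K) -> Prop.

(* By the inverse function theorem, these are the local changes of coordinates
   of class C fixing 0. *)
Definition local_coordinates (phi : 'I_N -> 'rV[K]_N -> K) : Prop :=
  [/\ forall i, C (phi i), forall i, phi i 0 = 0 &
      (\matrix_(i < N, k < N) pd (phi i) k 0) \in unitmx].

Definition linearizable (pi : 'I_N -> 'I_N -> 'rV[K]_N -> K) : Prop :=
  exists phi : 'I_N -> 'rV[K]_N -> K, local_coordinates phi /\
    \forall x \near (0 : 'rV[K]_N), forall i j,
      \sum_(k < N) \sum_(l < N) pi k l x * (pd (phi i) k x * pd (phi j) l x)
      = \sum_(k < N) linear_part pi i j k * phi k x.

End Germs.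

Definition degenerate_in (K : numFieldType)
    (C : forall N : nat, ('rV[K]_N -> K) -> Prop) (g : lieAlgebra K) : Prop :=
  exists (N : nat) (pi : 'I_N -> 'I_N -> 'rV[K]_N -> K),
    [/\ forall i j, C N (pi i j), poisson_near0 pi, vanishing_at0 pi,
        structure_constants g (linear_part pi) & ~ linearizable (C N) pi].

Definition analytically_degenerate (K : numFieldType) (g : lieAlgebra K) :=
  degenerate_in (@analytic_near0 K) g.

Definition smoothly_degenerate (R : realType) (g : lieAlgebra R) :=
  degenerate_in (@smooth_near0 R) g.

(* Main.v *)
(* In both semidirect products h |x K^n the linear Poisson structure is perturbed
   only in the bracket of two coordinates y of the abelian ideal. Suppose that phi
   linearizes the perturbed structure Pi, let J be its Jacobian matrix and Y its
   components along K^n. The matrix J Pi J^T is the linear model evaluated at phi,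
   and suitable 4x4 Pfaffians of the model are products Y_a Y_b up to sign; on the
   other hand they are combinations of the 4x4 minors of J with the Pfaffians of
   Pi as coefficients.

   For e(3), Pi has rank 2 along x = t e_m, y = 0 and along x = t e_m,
   y = t^3 e_m, so Y vanishes on both curves. Comparing them gives dY(0) = 0,
   contradicting the invertibility of J(0).

   For saff(2), Pi has rank 2 along the axes e and f, where Y therefore vanishes;
   hence Y = O(t^3) on the curve e = t, f = t^3. There the Pfaffian identity reads
   8 t^5 minor(J) + O(t^7) = O(t^6), so three 4x4 minors of J(0) vanish, and
   det J(0) = 0 by expansion along the column of f.

   Restricting to a curve is a ring morphism to K[[t]] in the formal case, and a
   limit t -> 0 that only needs strict differentiability at 0 otherwise. *)

Require Import Defs.
From HB Require Import structures.
From mathcomp Require Import all_boot all_order all_algebra.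
From mathcomp Require Import all_classical all_reals all_analysis.
From mathcomp Require Import ring lra zify.

Set Implicit Arguments.
Unset Strict Implicit.
Unset Printing Implicit Defensive.

Import Order.TTheory GRing.Theory Num.Theory.
Import numFieldNormedType.Exports.

Local Open Scope classical_set_scope.
Local Open Scope ring_scope.

(** * The ring of formal power series *)

(** A linearization maps the points where Pi has rank at most 2 to such points of the model, and
    these form the subspace Y = 0; the perturbations are chosen to alter this set. Formal series
    have no points, so ranks are replaced by Pfaffians: these give polynomial identities over any
    commutative ring, applied in K itself for germs and in K[[t]] for formal series.

    For e(3), the so(4) structure with parameter c has rank at most 2 where y = mu x with mu^2 = c.
    Putting c = x . y and x = t e_m gives mu^2 = t^2 mu, whose roots 0 and t^2 are the two curves.

    For saff(2), the rank drops on the cone h^2 + 4 e f = 0, y = 0, which contains both axes but not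
    the plane they span. On e = t, f = t^k the Pfaffians of Pi have leading term 8 t^(k+2) times a
    minor of J, while Y = O(t^k) makes the products Y_a Y_b of order 2k. The minors are forced to
    vanish at 0 once k > 2, and k = 3 is the least such exponent. Thus the exponent 3 serves both
    algebras, for different reasons. *)

Section MultiIndex.
Variable N : nat.
Implicit Types m : multiindex N.

(** Sums over multi-indices run over boxes {0, ..., M-1}^N, which are finite types; forgetting the
    bound lets boxes of different sizes be compared. *)
Definition box_mi M (b : {ffun 'I_N -> 'I_M}) : multiindex N :=
  [ffun i => b i : nat].

Lemma box_mi_inj M : injective (@box_mi M).
Proof.
move=> a b /ffunP eab; apply/ffunP => i; apply: val_inj.
by have := eab i; rewrite !ffunE.
Qed.

Lemma box_mi_surj M m : (forall i, m i < M)%N ->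
  exists b : {ffun 'I_N -> 'I_M}, box_mi b = m.
Proof.
move=> mM; exists [ffun i => Ordinal (mM i)].
by apply/ffunP => i; rewrite !ffunE.
Qed.

Lemma miaddC : commutative (@miadd N).
Proof. by move=> a b; apply/ffunP => i; rewrite !ffunE addnC. Qed.

Lemma miaddA : associative (@miadd N).
Proof. by move=> a b c; apply/ffunP => i; rewrite !ffunE addnA. Qed.

Lemma miadd0 : left_id (mi0 N) (@miadd N).
Proof. by move=> a; apply/ffunP => i; rewrite !ffunE. Qed.

Lemma miaddI a : injective (@miadd N a).
Proof.
move=> b c /ffunP e; apply/ffunP => i; apply/eqP.
by rewrite -(eqn_add2l (a i)); have := e i; rewrite !ffunE => ->.
Qed.

Section Sums.
Variable A : nmodType.

Lemma box_sum_pick M (F : multiindex N -> A) m : (forall i, m i < M)%N ->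
  \sum_(b : {ffun 'I_N -> 'I_M} | box_mi b == m) F (box_mi b) = F m.
Proof.
move=> /box_mi_surj [b0 <-].
by under eq_bigl => b do rewrite (inj_eq (@box_mi_inj M)); rewrite big_pred1_eq.
Qed.

Lemma box_sum_pick0 M (F : multiindex N -> A) m :
  ~~ [forall i, m i < M]%N ->
  \sum_(b : {ffun 'I_N -> 'I_M} | box_mi b == m) F (box_mi b) = 0.
Proof.
move=> mM; apply: big1 => b /eqP bm; case/negP: mM; apply/forallP => i.
by rewrite -bm ffunE.
Qed.

Lemma box_sum_pick_supp M (F : multiindex N -> A) m :
  (F m != 0%R -> forall i, m i < M)%N ->
  \sum_(b : {ffun 'I_N -> 'I_M} | box_mi b == m) F (box_mi b) = F m.
Proof.
have [mM _|mM Fm] := boolP [forall i, m i < M]%N.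
  exact/box_sum_pick/forallP.
rewrite box_sum_pick0 //; apply/esym/eqP/negPn/negP => /Fm.
by move/forallP; apply/negP.
Qed.

Lemma box_sum_widen M M' (F : multiindex N -> A) : (M <= M')%N ->
  (forall m, F m != 0%R -> forall i, m i < M)%N ->
  \sum_(b : {ffun 'I_N -> 'I_M'}) F (box_mi b)
  = \sum_(b : {ffun 'I_N -> 'I_M}) F (box_mi b).
Proof.
move=> MM' FM.
transitivity (\sum_(d : {ffun 'I_N -> 'I_M}) \sum_(c : {ffun 'I_N -> 'I_M'}
    | box_mi c == box_mi d) F (box_mi c)); last first.
  apply: eq_bigr => d _; rewrite box_sum_pick // => i.
  by rewrite ffunE (leq_trans (ltn_ord _)).
rewrite (exchange_big_dep xpredT) //=; apply: eq_bigr => c _.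
under eq_bigl => d do rewrite eq_sym.
have [/FM cM|/negPn/eqP Fc0] := boolP (F (box_mi c) != 0); last first.
  by rewrite Fc0 big1.
by rewrite (box_sum_pick (fun=> F (box_mi c)) cM).
Qed.

End Sums.
End MultiIndex.

Section FormalSeries.
Variables (K : numFieldType) (N : nat).
Implicit Types (f g h : fps K N) (m : multiindex N).

(** The defining sum is asymmetric and its range depends on [m]. Written over pairs with a + b = m
    in any box containing [m], the product is symmetric, and the ring laws become exchanges of
    summation. *)
Lemma fps_mulE M f g m : (forall i, m i < M)%N ->
  fps_mul f g m =
  \sum_(a : {ffun 'I_N -> 'I_M}) \sum_(b : {ffun 'I_N -> 'I_M}
     | miadd (box_mi a) (box_mi b) == m) f (box_mi a) * g (box_mi b).
Proof.
move=> mM.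
have mS i : (m i < (\sum_(j < N) m j).+1)%N by rewrite ltnS (bigD1 i) //= leq_addr.
pose F (a : multiindex N) := if [forall i, a i <= m i]%N then f a * g (misub m a) else 0.
transitivity (\sum_(a : {ffun 'I_N -> 'I_(\sum_(j < N) m j)%N.+1}) F (box_mi a)).
  rewrite /fps_mul big_mkcond; apply: eq_bigr => a _; rewrite /F.
  by under [in RHS]eq_forallb => i do rewrite ffunE.
have Fbig M' a : (forall i, m i < M')%N -> F a != 0%R -> (forall i, a i < M')%N.
  rewrite /F => mM'; case: ifP => [/forallP am _ i|]; last by rewrite eqxx.
  exact: leq_ltn_trans (am i) (mM' i).
transitivity (\sum_(a : {ffun 'I_N -> 'I_M}) F (box_mi a)).
  have [le|/ltnW le] := leqP (\sum_(j < N) m j).+1 M.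
    by symmetry; apply: box_sum_widen => // a /Fbig; apply.
  by apply: box_sum_widen => // a /Fbig; apply.
apply: eq_bigr => a _; rewrite /F; case: ifPn => [/forallP am|/negP am].
  rewrite -(@box_sum_pick _ _ M (fun b => f (box_mi a) * g b)); last first.
    by move=> i; rewrite ffunE (leq_ltn_trans (leq_subr _ _)).
  apply: eq_bigl => b; apply/eqP/eqP => /ffunP e; apply/ffunP => i.
    by have := e i; have := am i; rewrite !ffunE => ai ->; rewrite subnKC.
  by have := e i; rewrite !ffunE => <-; rewrite addKn.
rewrite big1 // => b /eqP e; case: am; apply/forallP => i.
by rewrite -e [leqRHS]ffunE leq_addr.
Qed.

Definition fps_one : fps K N := fun m => (m == mi0 N)%:R.

Definition fps_var (k : 'I_N) : fps K N := fun m => (m == mi1 k)%:R.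

HB.instance Definition _ := GRing.Zmodule.copy (fps K N) (multiindex N -> K).

Lemma fps_addE f g m : (f + g) m = f m + g m. Proof. by []. Qed.

Let mi_bound m i : (m i < (\sum_(j < N) m j).+1)%N.
Proof. by rewrite ltnS (bigD1 i) //= leq_addr. Qed.

Lemma fps_mulC : commutative (@fps_mul K N).
Proof.
move=> f g; apply/funext => m; rewrite !(fps_mulE _ _ (mi_bound m)).
rewrite (exchange_big_dep xpredT) //=; apply: eq_bigr => a _.
under eq_bigl => b do rewrite miaddC.
by apply: eq_bigr => b _; rewrite mulrC.
Qed.

(** Symmetric form of a triple product. Associativity then follows with the help of commutativity,
    which brings f (g h) into the shape (g h) f. *)
Lemma fps_mul_triple M f g h m : (forall i, m i < M)%N ->
  fps_mul (fps_mul f g) h m =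
  \sum_(a : {ffun 'I_N -> 'I_M}) \sum_(b : {ffun 'I_N -> 'I_M})
    \sum_(c : {ffun 'I_N -> 'I_M}
       | miadd (miadd (box_mi a) (box_mi b)) (box_mi c) == m)
    f (box_mi a) * g (box_mi b) * h (box_mi c).
Proof.
move=> mM; rewrite (fps_mulE _ _ mM).
transitivity (\sum_(d : {ffun 'I_N -> 'I_M}) \sum_(c : {ffun 'I_N -> 'I_M}
     | miadd (box_mi d) (box_mi c) == m)
     \sum_(a : {ffun 'I_N -> 'I_M}) \sum_(b : {ffun 'I_N -> 'I_M}
       | miadd (box_mi a) (box_mi b) == box_mi d)
     f (box_mi a) * g (box_mi b) * h (box_mi c)).
  apply: eq_bigr => d _; apply: eq_bigr => c _.
  rewrite (fps_mulE _ _ (M := M)) => [|i]; last by rewrite ffunE.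
  by rewrite mulr_suml; apply: eq_bigr => a _; rewrite mulr_suml.
rewrite (exchange_big_dep xpredT) //=.
under eq_bigr => c _ do rewrite exchange_big.
rewrite exchange_big /=; apply: eq_bigr => a _.
under eq_bigr => c _ do rewrite (exchange_big_dep xpredT) //=.
rewrite exchange_big /=; apply: eq_bigr => b _.
rewrite [RHS]big_mkcond /=; apply: eq_bigr => c _.
under eq_bigl => d do rewrite andbC eq_sym.
rewrite big_mkcondr /=.
(* The sum a + b may leave the box and is then missing among the indices d; but in that case a + b +
   c = m is impossible too. *)
have [abM|abM] := boolP [forall i, miadd (box_mi a) (box_mi b) i < M]%N.
  move/forallP: abM => abM.
  exact: (box_sum_pick (fun d => if miadd d (box_mi c) == m then _ else 0) abM).
rewrite (box_sum_pick0 (fun d => if miadd d (box_mi c) == m then _ else 0) abM).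
case: ifP => // /eqP e; case/negP: abM; apply/forallP => i.
by apply: leq_ltn_trans (mM i); rewrite -e [leqRHS]ffunE leq_addr.
Qed.

Lemma fps_mulA : associative (@fps_mul K N).
Proof.
move=> f g h; apply/funext => m; rewrite fps_mulC.
rewrite !(fps_mul_triple _ _ _ (mi_bound m)).
rewrite [RHS]exchange_big /=; under [RHS]eq_bigr => b _ do
  under eq_bigr => a _ do rewrite big_mkcond.
under [RHS]eq_bigr => b _ do rewrite exchange_big /=.
apply: eq_bigr => b _; apply: eq_bigr => c _.
rewrite big_mkcond /=; apply: eq_bigr => a _.
by rewrite (miaddC _ (box_mi a)) miaddA; case: ifP; rewrite // mulrC mulrA.
Qed.

Lemma fps_mul1 : left_id fps_one (@fps_mul K N).
Proof.
move=> f; apply/funext => m; rewrite (fps_mulE _ _ (mi_bound m)).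
have [a0 a0E] : exists a : {ffun 'I_N -> 'I_(\sum_(j < N) m j)%N.+1},
    box_mi a = mi0 N by apply: box_mi_surj => i; rewrite ffunE.
rewrite (bigD1 a0) //= [X in _ + X]big1 ?addr0 => [|a aa0].
  rewrite a0E; under eq_bigl => b do rewrite miadd0.
  rewrite (box_sum_pick (fun b => fps_one (mi0 N) * f b) (mi_bound m)).
  by rewrite /fps_one eqxx mul1r.
rewrite big1 // => b _; rewrite /fps_one -a0E (inj_eq (@box_mi_inj _ _)).
by rewrite (negPf aa0) mul0r.
Qed.

Lemma fps_mulDl : left_distributive (@fps_mul K N) +%R.
Proof.
move=> f g h; apply/funext => m.
rewrite fps_addE !(fps_mulE _ _ (mi_bound m)) -big_split /=.
apply: eq_bigr => a _; rewrite -big_split /=; apply: eq_bigr => b _.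
by rewrite fps_addE mulrDl.
Qed.

Lemma fps_one_neq0 : fps_one != 0.
Proof.
apply/eqP => /(congr1 (fun f : fps K N => f (mi0 N))) /eqP.
by rewrite /fps_one eqxx oner_eq0.
Qed.

HB.instance Definition _ := GRing.Zmodule_isComNzRing.Build (fps K N)
  fps_mulA fps_mulC fps_mul1 fps_mulDl fps_one_neq0.

Lemma fps_sumE (I : Type) (r : seq I) (P : pred I) (F : I -> fps K N) m :
  (\sum_(i <- r | P i) F i) m = \sum_(i <- r | P i) F i m.
Proof. by elim/big_rec2: _ => //= i y1 y2 _ <-. Qed.

End FormalSeries.

(** * Formal partial derivatives *)

Section FormalDerivatives.
Variables (K : numFieldType) (N : nat).
Implicit Types (f g h : fps K N) (m : multiindex N).

Let mi_bound m i : (m i < (\sum_(j < N) m j).+1)%N.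
Proof. by rewrite ltnS (bigD1 i) //= leq_addr. Qed.

Lemma fps_coefM M f g m : (forall i, m i < M)%N -> (f * g) m =
  \sum_(a : {ffun 'I_N -> 'I_M}) \sum_(b : {ffun 'I_N -> 'I_M}
     | miadd (box_mi a) (box_mi b) == m) f (box_mi a) * g (box_mi b).
Proof. exact: fps_mulE. Qed.

Lemma fps_coef0M f g : (f * g) (mi0 N) = f (mi0 N) * g (mi0 N).
Proof.
rewrite (@fps_coefM 1) => [|i]; last by rewrite ffunE.
transitivity (\sum_(a : {ffun 'I_N -> 'I_1}) f (mi0 N) * g (mi0 N)).
  apply: eq_bigr => a _; have e (c : {ffun 'I_N -> 'I_1}) : box_mi c = mi0 N.
    by apply/ffunP => i; rewrite !ffunE; case: (c i) => -[].
  rewrite (big_pred1 a) ?e // => b; rewrite !e miadd0 eqxx; symmetry.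
  by apply/eqP/(@box_mi_inj _ 1); rewrite !e.
by rewrite sumr_const card_ffun card_ord exp1n.
Qed.

Lemma fps_varM k f m : (fps_var K k * f) (miadd (mi1 k) m) = f m.
Proof.
have mM := mi_bound (miadd (mi1 k) m).
rewrite (fps_coefM _ _ mM).
set M := (\sum_(j < N) _).+1 in mM *.
have kM i : (mi1 k i < M)%N.
  by apply: leq_ltn_trans (mM i); rewrite [leqRHS]ffunE leq_addr.
have {}mM i : (m i < M)%N.
  by apply: leq_ltn_trans (mM i); rewrite [leqRHS]ffunE leq_addl.
rewrite -[RHS](box_sum_pick (fun=> f m) kM) [RHS]big_mkcond.
apply: eq_bigr => a _; rewrite /fps_var.
have [->|_] := eqVneq (box_mi a) (mi1 k); last first.
  by apply: big1 => b _; rewrite mul0r.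
rewrite -[RHS](box_sum_pick f mM).
by apply: eq_big => [b|b _]; rewrite ?mul1r // (inj_eq (@miaddI _ _)).
Qed.

Lemma fps_var_reg k f : fps_var K k * f = 0 -> f = 0.
Proof.
move=> e; apply/funext => m.
by rewrite -(fps_varM k) e.
Qed.

Lemma fps_varM0 k f m : m k = 0%N -> (fps_var K k * f) m = 0.
Proof.
move=> mk; rewrite (fps_coefM _ _ (mi_bound _)).
apply: big1 => a _; apply: big1 => b /eqP e; rewrite /fps_var.
case: eqP => [ea|]; last by rewrite mul0r.
by move/ffunP/(_ k): e; rewrite ea !ffunE eqxx mk.
Qed.

(** The Euler operator z_k d/dz_k. It is diagonal on monomials with the additive eigenvalue m_k, so
    its Leibniz rule holds coefficient by coefficient, whereas [fps_pd] shifts indices. Cancelling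
    z_k transfers the rule to [fps_pd]. *)
Definition fps_euler k f : fps K N := fun m => f m *+ m k.

Lemma fps_eulerE k f : fps_euler k f = fps_var K k * fps_pd f k.
Proof.
apply/funext => m; rewrite /fps_euler.
have [mk|mk] := posnP (m k); first by rewrite fps_varM0 // mk.
have -> : m = miadd (mi1 k) (misub m (mi1 k)).
  apply/ffunP => i; rewrite !ffunE; case: eqP => [->|_]; last by rewrite subn0.
  by rewrite subnKC.
rewrite fps_varM /fps_pd miaddC; congr (_ *+ _).
by rewrite !ffunE eqxx addn1.
Qed.

Lemma fps_eulerM k f g :
  fps_euler k (f * g) = fps_euler k f * g + f * fps_euler k g.
Proof.
apply/funext => m; rewrite fps_addE {1}/fps_euler.
rewrite !(fps_coefM _ _ (mi_bound m)) -sumrMnl -big_split /=.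
apply: eq_bigr => a _; rewrite -sumrMnl -big_split /=.
apply: eq_bigr => b /eqP/ffunP/(_ k); rewrite /fps_euler [miadd _ _ k]ffunE => <-.
by rewrite mulrnDr -mulrnAl -mulrnAr.
Qed.

Lemma fps_pdM k f g : fps_pd (f * g) k = fps_pd f k * g + f * fps_pd g k.
Proof.
apply/eqP; rewrite -subr_eq0; apply/eqP/(@fps_var_reg k).
rewrite mulrBr -fps_eulerE fps_eulerM !fps_eulerE; ring.
Qed.

Lemma fps_pdD k f g : fps_pd (f + g) k = fps_pd f k + fps_pd g k.
Proof. by apply/funext => m; rewrite /fps_pd fps_addE mulrnDl. Qed.

Lemma fps_pdN k f : fps_pd (- f) k = - fps_pd f k.
Proof. by apply/funext => m; rewrite /fps_pd mulNrn. Qed.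

Lemma fps_pd1 k : fps_pd (1 : fps K N) k = 0.
Proof.
apply/funext => m; rewrite /fps_pd /GRing.one /= /fps_one.
case: eqP => [/ffunP /(_ k)|]; last by rewrite mul0rn.
by rewrite !ffunE eqxx addn1.
Qed.

Lemma fps_pd_var (k l : 'I_N) : fps_pd (fps_var K k : fps K N) l = (k == l)%:R :> fps K N.
Proof.
apply/funext => m; rewrite /fps_pd /fps_var.
have [<-|kl] := eqVneq k l.
  have -> : (miadd m (mi1 k) == mi1 k) = (m == mi0 N).
    by rewrite -{2}(miadd0 (mi1 k)) !(miaddC _ (mi1 k)) (inj_eq (@miaddI _ _)).
  rewrite -[RHS]/((m == mi0 N)%:R : K).
  by case: eqP => [->|_]; rewrite ?ffunE ?mul0rn.
case: eqP => [/ffunP /(_ l)|]; last by rewrite mul0rn.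
by rewrite !ffunE eqxx eq_sym (negPf kl) addn1.
Qed.

End FormalDerivatives.

(** * Power series in one variable and their order of vanishing *)

Section OneVariable.
Variable K : numFieldType.
Implicit Types F G : fps K 1.

Definition mi_cst n : multiindex 1 := [ffun=> n].

Lemma mi_cstE (m : multiindex 1) : m = mi_cst (m ord0).
Proof. by apply/ffunP => i; rewrite ffunE ord1. Qed.

Definition order_ge n F := forall k, (k < n)%N -> F (mi_cst k) = 0.

Lemma order_mul p q F G : order_ge p F -> order_ge q G ->
  order_ge (p + q) (F * G) /\
  (F * G) (mi_cst (p + q)) = F (mi_cst p) * G (mi_cst q).
Proof.
move=> Fp Gq; have e n : (F * G) (mi_cst n) =
  \sum_(a : {ffun 'I_1 -> 'I_n.+1}) \sum_(b : {ffun 'I_1 -> 'I_n.+1}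
     | miadd (box_mi a) (box_mi b) == mi_cst n) F (box_mi a) * G (box_mi b).
  by apply: (@fps_coefM _ _ n.+1) => i; rewrite ffunE.
have z n (a b : {ffun 'I_1 -> 'I_n.+1}) : (a ord0 < p)%N || (b ord0 < q)%N ->
    F (box_mi a) * G (box_mi b) = 0.
  case/orP => h; rewrite (mi_cstE (box_mi a)) (mi_cstE (box_mi b)).
    by rewrite Fp ?mul0r // ffunE.
  by rewrite Gq ?mulr0 // ffunE.
split=> [k kpq|].
  rewrite e; apply: big1 => a _; apply: big1 => b /eqP/ffunP/(_ ord0).
  rewrite !ffunE => ab; apply: z; apply: contraTT kpq.
  rewrite negb_or -!leqNgt => /andP[pa qb].
  by move: (leq_add pa qb); rewrite ab.
rewrite e.
transitivity (\sum_(a : {ffun 'I_1 -> 'I_(p + q).+1} | box_mi a == mi_cst p)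
   \sum_(b : {ffun 'I_1 -> 'I_(p + q).+1} | box_mi b == mi_cst q)
   F (box_mi a) * G (box_mi b)).
  rewrite [RHS]big_mkcond; apply: eq_bigr => a _.
  have [->|ap] := eqVneq (box_mi a) (mi_cst p).
    apply: eq_bigl => b; have -> : mi_cst (p + q) = miadd (mi_cst p) (mi_cst q).
      by apply/ffunP => i; rewrite !ffunE.
    by rewrite (inj_eq (@miaddI _ _)).
  apply: big1 => b /eqP/ffunP/(_ ord0); rewrite !ffunE => ab; apply: z.
  have {ap} : (a ord0 != p :> nat).
    by apply: contra ap => /eqP ap; rewrite [box_mi a]mi_cstE ffunE ap.
  case: ltngtP => //= pa _; move: ab pa.
  move: (nat_of_ord _) (nat_of_ord _) => x y; lia.
have pM i : (mi_cst p i < (p + q).+1)%N by rewrite ffunE ltnS leq_addr.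
have qM i : (mi_cst q i < (p + q).+1)%N by rewrite ffunE ltnS leq_addl.
under eq_bigr => a _ do rewrite (box_sum_pick (fun b => F (box_mi a) * G b) qM).
by rewrite (box_sum_pick (fun a => F a * G (mi_cst q)) pM).
Qed.

(** If F = O(t^n), the coefficient of t^(2n) in F^2 is the square of the coefficient of t^n in F;
    hence the order of F can be raised indefinitely. *)
Lemma fps1_sqr_eq0 F : F ^+ 2 = 0 -> F = 0.
Proof.
move=> F0; have Fn n : order_ge n F.
  elim: n => [//|n IH] k; rewrite ltnS leq_eqVlt => /predU1P[->|/IH//].
  have [_] := order_mul IH IH; rewrite -expr2 F0 => /esym/eqP.
  by rewrite mulf_eq0 orbb => /eqP.
by apply/funext => m; rewrite [m]mi_cstE (Fn (m ord0).+1).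
Qed.

Lemma coef_varXn n m : (fps_var K (ord0 : 'I_1) ^+ n) m = (m ord0 == n)%:R.
Proof.
elim: n m => [|n IH] m.
  rewrite expr0 {1}/GRing.one /= /fps_one; congr (nat_of_bool _)%:R.
  by rewrite [m]mi_cstE; apply/eqP/eqP => [->|]; rewrite !ffunE // => ->.
rewrite exprS; case E: (m ord0) => [|k]; first by rewrite fps_varM0.
have -> : m = miadd (mi1 ord0) (mi_cst k).
  by rewrite [m]mi_cstE E; apply/ffunP => i; rewrite !ffunE ord1 eqxx add1n.
by rewrite fps_varM IH ffunE.
Qed.

Lemma order_varXn n F : order_ge n (fps_var K (ord0 : 'I_1) ^+ n * F) /\
  (fps_var K (ord0 : 'I_1) ^+ n * F) (mi_cst n) = F (mi_cst 0).
Proof.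
have h : order_ge n (fps_var K (ord0 : 'I_1) ^+ n).
  by move=> k kn; rewrite coef_varXn ffunE; case: eqP kn => // ->; rewrite ltnn.
have [] := @order_mul n 0 (fps_var K (ord0 : 'I_1) ^+ n) F h => //.
by rewrite addn0 coef_varXn ffunE eqxx mul1r.
Qed.

End OneVariable.

(** * Restriction of power series to monomial curves *)

Lemma exchange_big4 (A : nmodType) (I J : finType) (F : I -> I -> J -> J -> A) :
  \sum_i \sum_i' \sum_j \sum_j' F i i' j j'
  = \sum_j \sum_j' \sum_i \sum_i' F i i' j j'.
Proof.
under eq_bigr => i _ do rewrite exchange_big.
rewrite exchange_big; apply: eq_bigr => j _.
under eq_bigr => i _ do rewrite exchange_big.
by rewrite exchange_big.
Qed.

Section Substitution.
Variables (K : numFieldType) (N : nat) (w : 'I_N -> nat) (v : {set 'I_N}).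
Hypothesis w_gt0 : forall l, (0 < w l)%N.
Implicit Types (f g : fps K N) (b : multiindex N).

Definition weight b : nat := (\sum_(l < N) w l * b l)%N.

Definition supported b := [forall l, (l \notin v) ==> (b l == 0%N)].

(* The series f (t ^ w_0, t ^ w_1, ...), where the variables outside v are
   set to 0. *)
Definition curve_subst f : fps K 1 := fun m =>
  \sum_(b : {ffun 'I_N -> 'I_(m ord0).+1}
     | (weight (box_mi b) == m ord0) && supported (box_mi b)) f (box_mi b).

(** Positive weights let only finitely many monomials contribute to a given power of t: those of
    weight n lie in the box of side n + 1. *)
Lemma weight_bound b i : (b i <= weight b)%N.
Proof.
by rewrite /weight (bigD1 i) //= (leq_trans (leq_pmull _ (w_gt0 i))) ?leq_addr.
Qed.

Lemma weightD a b : weight (miadd a b) = (weight a + weight b)%N.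
Proof.
by rewrite /weight -big_split; apply: eq_bigr => l _; rewrite ffunE mulnDr.
Qed.

Lemma supportedD a b : supported (miadd a b) = supported a && supported b.
Proof.
apply/forallP/andP => [h|[/forallP ha /forallP hb] l].
  by split; apply/forallP => l; apply/implyP => /(implyP (h l));
    rewrite ffunE addn_eq0 => /andP[].
apply/implyP => lv; rewrite ffunE addn_eq0.
by rewrite (implyP (ha l)) // (implyP (hb l)).
Qed.

Lemma curve_substE M f (m : multiindex 1) : (m ord0 < M)%N -> curve_subst f m =
  \sum_(b : {ffun 'I_N -> 'I_M}
     | (weight (box_mi b) == m ord0) && supported (box_mi b)) f (box_mi b).
Proof.
move=> mM; rewrite /curve_subst big_mkcond [RHS]big_mkcond /=; symmetry.
pose F b := if (weight b == m ord0) && supported b then f b else 0.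
apply: (box_sum_widen (F := F)) => // b; rewrite /F.
case: ifP => [/andP[/eqP <- _] _ i|]; last by rewrite eqxx.
by rewrite ltnS weight_bound.
Qed.

Lemma curve_substD f g : curve_subst (f + g) = curve_subst f + curve_subst g.
Proof. by apply/funext => m; rewrite fps_addE -big_split. Qed.

Lemma curve_substM f g : curve_subst (f * g) = curve_subst f * curve_subst g.
Proof.
apply/funext => m; set M := (m ord0).+1.
pose X (a b : multiindex N) := if (weight (miadd a b) == m ord0)
   && supported (miadd a b) then f a * g b else 0.
transitivity (\sum_(a : {ffun 'I_N -> 'I_M}) \sum_(b : {ffun 'I_N -> 'I_M})
   X (box_mi a) (box_mi b)).
  rewrite (@curve_substE M) //.
  transitivity (\sum_(c : {ffun 'I_N -> 'I_M}) \sum_(a : {ffun 'I_N -> 'I_M})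
     \sum_(b : {ffun 'I_N -> 'I_M} | miadd (box_mi a) (box_mi b) == box_mi c)
       X (box_mi a) (box_mi b)).
    rewrite big_mkcond /=; apply: eq_bigr => c _; case: ifP => wc.
      rewrite (fps_coefM _ _ (M := M)) => [|i]; last by rewrite ffunE.
      by apply: eq_bigr => a _; apply: eq_bigr => b /eqP abc; rewrite /X abc wc.
    symmetry; apply: big1 => a _; apply: big1 => b /eqP abc.
    by rewrite /X abc wc.
  rewrite exchange_big /=; apply: eq_bigr => a _.
  rewrite (exchange_big_dep xpredT) //=; apply: eq_bigr => b _.
  under eq_bigl => c do rewrite eq_sym.
  rewrite (box_sum_pick_supp (F := fun=> X (box_mi a) (box_mi b))) //.
  rewrite /X; case: ifP => [/andP[/eqP e _] _ i|]; last by rewrite eqxx.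
  by have := weight_bound (miadd (box_mi a) (box_mi b)) i; rewrite e.
rewrite (fps_coefM _ _ (M := M)) => [|i]; last by rewrite ord1.
(* The indices p and q record the powers of t contributed by a and b. Summing them out first leaves
   the product taken before substitution; summing out a and b first gives the product taken after
   it. *)
pose Y a b (p q : {ffun 'I_1 -> 'I_M}) :=
  if [&& supported a, supported b, box_mi p == mi_cst (weight a),
         box_mi q == mi_cst (weight b) & miadd (box_mi p) (box_mi q) == m]
  then f a * g b else 0.
transitivity (\sum_(a : {ffun 'I_N -> 'I_M}) \sum_(b : {ffun 'I_N -> 'I_M})
   \sum_(p : {ffun 'I_1 -> 'I_M}) \sum_(q : {ffun 'I_1 -> 'I_M})
   Y (box_mi a) (box_mi b) p q).
  apply: eq_bigr => a _; apply: eq_bigr => b _.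
  rewrite /X supportedD weightD /Y; move: (box_mi a) (box_mi b) => {}a {}b.
  case sa: (supported a); last by rewrite !big1 ?andbF // => p _; rewrite big1.
  case sb: (supported b); last by rewrite !big1 ?andbF // => p _; rewrite big1.
  pose G (p q : multiindex 1) := if miadd p q == m then f a * g b else 0.
  have mE (p q : multiindex 1) : (miadd p q == m) = (p ord0 + q ord0 == m ord0)%N.
    apply/eqP/eqP => [<-|e]; first by rewrite ffunE.
    by rewrite [m]mi_cstE -e; apply/ffunP => i; rewrite !ffunE ord1.
  rewrite /= andbT.
  transitivity (\sum_(p : {ffun 'I_1 -> 'I_M} | box_mi p == mi_cst (weight a))
      G (box_mi p) (mi_cst (weight b))).
    rewrite (box_sum_pick_supp (F := fun p => G p (mi_cst (weight b)))).
      by rewrite /G mE !ffunE.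
    rewrite /G mE !ffunE; case: ifP => [/eqP e _ i|_]; last by rewrite eqxx.
    by rewrite ffunE /M -e ltnS leq_addr.
  rewrite big_mkcond; apply: eq_bigr => p _.
  case: ifP => _ /=; last by rewrite big1.
  transitivity (\sum_(q : {ffun 'I_1 -> 'I_M} | box_mi q == mi_cst (weight b))
      G (box_mi p) (box_mi q)).
    symmetry; apply: (box_sum_pick_supp (F := G (box_mi p))).
    rewrite /G mE !ffunE; case: ifP => [/eqP e _ i|_]; last by rewrite eqxx.
    by rewrite ffunE /M -e ltnS leq_addl.
  by rewrite big_mkcond; apply: eq_bigr => q _; case: (box_mi q == _).
rewrite exchange_big4.
apply: eq_bigr => p _; rewrite [RHS]big_mkcond; apply: eq_bigr => q _.
case: ifP => pq; last first.
  by apply: big1 => a _; apply: big1 => b _; rewrite /Y pq !andbF.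
have sE (r : {ffun 'I_1 -> 'I_M}) h : curve_subst h (box_mi r) =
   \sum_(a : {ffun 'I_N -> 'I_M})
     if supported (box_mi a) && (box_mi r == mi_cst (weight (box_mi a)))
     then h (box_mi a) else 0.
  rewrite (@curve_substE M) => [|]; last by rewrite ffunE.
  rewrite -big_mkcondr; apply: eq_bigl => a; rewrite andbC; congr (_ && _).
  rewrite [box_mi r]mi_cstE; apply/eqP/eqP => [->|/ffunP/(_ ord0)].
    by apply/ffunP => i; rewrite !ffunE.
  by rewrite !ffunE.
rewrite !sE mulr_suml; apply: eq_bigr => a _.
rewrite mulr_sumr; apply: eq_bigr => b _; rewrite /Y pq andbT.
case: (supported (box_mi a)) => /=; last by rewrite mul0r.
case: (supported (box_mi b)) => /=; last by rewrite mulr0.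
by case: (box_mi p == _); case: (box_mi q == _); rewrite /= ?mul0r ?mulr0.
Qed.

Lemma curve_subst1 : curve_subst 1 = 1.
Proof.
apply/funext => m; rewrite /curve_subst.
transitivity (\sum_(b : {ffun 'I_N -> 'I_(m ord0).+1} | box_mi b == mi0 N)
   (m ord0 == 0%N)%:R : K).
  rewrite big_mkcond [RHS]big_mkcond; apply: eq_bigr => b _.
  rewrite {1}/GRing.one /= /fps_one.
  have [->|_] := eqVneq (box_mi b) (mi0 N); last by case: ifP.
  have -> : weight (mi0 N) = 0%N by apply: big1 => l _; rewrite ffunE muln0.
  have -> : supported (mi0 N) by apply/forallP => l; rewrite ffunE implybT.
  by rewrite andbT eq_sym; case: eqP.
rewrite (box_sum_pick (fun=> (m ord0 == 0%N)%:R : K)).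
  rewrite [RHS]/GRing.one /= /fps_one; congr (nat_of_bool _)%:R.
  rewrite [in RHS](mi_cstE m); apply/eqP/eqP => [->|/ffunP/(_ ord0)].
    by apply/ffunP => i; rewrite !ffunE.
  by rewrite !ffunE.
by move=> i; rewrite ffunE.
Qed.

Lemma curve_subst_coef0 f : curve_subst f (mi_cst 0) = f (mi0 N).
Proof.
rewrite (@curve_substE 1) ?ffunE // (eq_bigl (fun c => box_mi c == mi0 N)).
  by apply: box_sum_pick => i; rewrite ffunE.
move=> b; apply/andP/eqP => [[/eqP wb _]|->].
  apply/ffunP => i; have := weight_bound (box_mi b) i.
  by rewrite wb leqn0 [RHS]ffunE => /eqP.
split; first by apply/eqP/big1 => l _; rewrite ffunE muln0.
by apply/forallP => l; rewrite ffunE implybT.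
Qed.

Lemma weight_mi1 k : weight (mi1 k) = w k.
Proof.
rewrite /weight (bigD1 k) //= ffunE eqxx muln1 big1 ?addn0 // => l lk.
by rewrite ffunE (negPf lk) muln0.
Qed.

Lemma supported_mi1 k : supported (mi1 k) = (k \in v).
Proof.
apply/forallP/idP => [/(_ k)|kv l]; first by rewrite ffunE eqxx implybF negbK.
by apply/implyP => lv; rewrite ffunE; have [lk|//] := eqVneq l k; rewrite lk kv in lv.
Qed.

Lemma curve_subst_var k : curve_subst (fps_var K k) =
  if k \in v then fps_var K (ord0 : 'I_1) ^+ w k else 0.
Proof.
apply/funext => m; rewrite /curve_subst /fps_var.
transitivity (\sum_(b : {ffun 'I_N -> 'I_(m ord0).+1} | box_mi b == mi1 k)
   ((w k == m ord0) && (k \in v))%:R : K).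
  rewrite big_mkcond [RHS]big_mkcond; apply: eq_bigr => b _.
  have [->|_] := eqVneq (box_mi b) (mi1 k); last by case: ifP.
  by rewrite weight_mi1 supported_mi1; case: ifP.
rewrite (box_sum_pick_supp (F := fun=> ((w k == m ord0) && (k \in v))%:R : K)).
  by case: ifP => kv; rewrite ?andbF // andbT coef_varXn eq_sym.
case wk: (w k == m ord0); last by rewrite eqxx.
by move=> _ i; rewrite ffunE; case: (i == k); rewrite // -(eqP wk) ltnS w_gt0.
Qed.

(** When no other supported monomial has the weight of z_k, the corresponding coefficient on the
    curve is the linear coefficient of z_k. In this way an entry of the Jacobian at 0 is read off a
    curve. *)
Lemma curve_subst_coef_min f k : k \in v ->
  (forall b, weight b = w k -> supported b -> b = mi1 k) ->
  curve_subst f (mi_cst (w k)) = f (mi1 k).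
Proof.
move=> kv h; rewrite (@curve_substE (w k).+1) ?ffunE //.
rewrite (eq_bigl (fun c => box_mi c == mi1 k)) => [|b].
  by apply: box_sum_pick => i; rewrite ffunE; case: (i == k); rewrite // ltnS w_gt0.
apply/andP/eqP => [[/eqP wb sb]|->]; first exact: h.
by rewrite weight_mi1 supported_mi1 eqxx.
Qed.

End Substitution.

(** * The perturbed Poisson structures *)

(** Polynomials with integer coefficients as syntax: one expression is evaluated in series, at
    points and along formal curves, and is differentiated symbolically, so that both categories use
    literally the same structure. *)
Inductive pexpr :=
  | PNat of nat
  | PVar of nat
  | PAdd of pexpr & pexpr
  | PMul of pexpr & pexpr
  | POpp of pexpr.

Fixpoint peval (A : comNzRingType) (z : nat -> A) (E : pexpr) : A :=
  match E with
  | PNat n => n%:R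
  | PVar k => z k
  | PAdd E F => peval z E + peval z F
  | PMul E F => peval z E * peval z F
  | POpp E => - peval z E
  end.

Fixpoint pderiv (l : nat) (E : pexpr) : pexpr :=
  match E with
  | PNat n => PNat 0
  | PVar k => PNat (k == l)
  | PAdd E F => PAdd (pderiv l E) (pderiv l F)
  | PMul E F => PAdd (PMul (pderiv l E) F) (PMul E (pderiv l F))
  | POpp E => POpp (pderiv l E)
  end.

Lemma peval_morph (A B : comNzRingType) (h : A -> B) (z : nat -> A) E :
  {morph h : x y / x + y} -> {morph h : x y / x * y} -> h 1 = 1 ->
  h (peval z E) = peval (h \o z) E.
Proof.
move=> hD hM h1; have h0 : h 0 = 0 by apply: (addrI (h 0)); rewrite -hD !addr0.
elim: E => [n|k|E IHE F IHF|E IHE F IHF|E IHE] //=.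
- by elim: n => // n IH; rewrite -!natr1 hD h1 IH.
- by rewrite hD IHE IHF.
- by rewrite hM IHE IHF.
- by apply: (addrI (h (peval z E))); rewrite -hD subrr h0 -IHE subrr.
Qed.

Lemma eq_peval (A : comNzRingType) (z z' : nat -> A) E :
  z =1 z' -> peval z E = peval z' E.
Proof.
by move=> zz; elim: E => //= [E -> F ->|E -> F ->|E ->].
Qed.

Definition antisymmetrize (U : nat -> nat -> pexpr) (i j : nat) : pexpr :=
  if (i < j)%N then U i j else if (j < i)%N then POpp (U j i) else PNat 0.

Lemma peval_antisymmetrize (A : comNzRingType) (z : nat -> A) U i j :
  peval z (antisymmetrize U i j) = - peval z (antisymmetrize U j i).
Proof.
by rewrite /antisymmetrize; case: ltngtP => _ /=; rewrite ?opprK ?oppr0.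
Qed.

(* h, e, f, u, v are the variables 0, ..., 4; the linear structure of saff(2) is
   perturbed by {u, v} = h^2 + 4 e f, which is invariant under sl(2). *)
Definition saff2_poisson : nat -> nat -> pexpr := antisymmetrize (fun i j =>
  match i, j with
  | 0, 1 => PMul (PNat 2) (PVar 1)
  | 0, 2 => POpp (PMul (PNat 2) (PVar 2))
  | 0, 3 => PVar 3
  | 0, 4 => POpp (PVar 4)
  | 1, 2 => PVar 0
  | 1, 4 => PVar 3
  | 2, 3 => PVar 4
  | 3, 4 => PAdd (PMul (PVar 0) (PVar 0))
                 (PMul (PNat 4) (PMul (PVar 1) (PVar 2)))
  | _, _ => PNat 0
  end)%N.

(* x_1, x_2, x_3, y_1, y_2, y_3 are the variables 0, ..., 5; the linear structure
   of e(3) is perturbed by {y_i, y_j} = (x . y) eps_ijk x_k. This is the bracket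
   {y_i, y_j} = c eps_ijk x_k of the so(4) family with the parameter c replaced by
   the Casimir function x . y, which is common to the whole family. *)
Definition e3_poisson : nat -> nat -> pexpr :=
  let xy := PAdd (PMul (PVar 0) (PVar 3)) (PAdd (PMul (PVar 1) (PVar 4))
                 (PMul (PVar 2) (PVar 5))) in
  antisymmetrize (fun i j =>
  match i, j with
  | 0, 1 => PVar 2
  | 0, 2 => POpp (PVar 1)
  | 1, 2 => PVar 0
  | 0, 4 => PVar 5
  | 0, 5 => POpp (PVar 4)
  | 1, 3 => POpp (PVar 5)
  | 1, 5 => PVar 3
  | 2, 3 => PVar 4
  | 2, 4 => POpp (PVar 3)
  | 3, 4 => PMul xy (PVar 2)
  | 3, 5 => POpp (PMul xy (PVar 1))
  | 4, 5 => PMul xy (PVar 0)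
  | _, _ => PNat 0
  end)%N.

(** Quantifying over all commutative rings turns the Jacobi identity into finitely many polynomial
    identities, valid for series and for values of functions alike. *)
Definition pjacobi N (E : nat -> nat -> pexpr) :=
  forall (A : comNzRingType) (z : nat -> A) (i j k : 'I_N),
  \sum_(l < N) (peval z (E i l) * peval z (pderiv l (E j k))
    + peval z (E j l) * peval z (pderiv l (E k i))
    + peval z (E k l) * peval z (pderiv l (E i j))) = 0.

Lemma saff2_jacobi : pjacobi 5 saff2_poisson.
Proof.
move=> A z [i hi] [j hj] [k hk]; rewrite !big_ord_recl big_ord0.
by move: i j k hi hj hk; do 3![case=> [|[|[|[|[|//]]]]]] => * /=; ring.
Qed.

Lemma e3_jacobi : pjacobi 6 e3_poisson.
Proof.
move=> A z [i hi] [j hj] [k hk]; rewrite !big_ord_recl big_ord0.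
by move: i j k hi hj hk; do 3![case=> [|[|[|[|[|[|//]]]]]]] => * /=; ring.
Qed.

(** * Pfaffians along curves *)

Section LaplaceExpansion.
Variable A : comNzRingType.
Implicit Type F : nat -> nat -> A.

(** Laplace expansion as a recursion on entries indexed by naturals: minors on explicit lists of
    rows and columns then unfold to polynomials that [ring] can treat. *)
Fixpoint ndet n F : A :=
  if n is n'.+1 then
    \sum_(k < n) F 0%N k * ((-1) ^+ k * ndet n' (fun i j => F i.+1 (bump k j)))
  else 1.

Lemma ndetS n F : ndet n.+1 F =
  \sum_(k < n.+1) F 0%N k * ((-1) ^+ k * ndet n (fun i j => F i.+1 (bump k j))).
Proof. by []. Qed.

Lemma ndetE n F : \det (\matrix_(i < n, j < n) F i j) = ndet n F.
Proof.
elim: n F => [|n IH] F; first by rewrite det_mx00.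
rewrite (expand_det_row _ ord0) /=; apply: eq_bigr => k _; rewrite mxE.
congr (_ * _); rewrite /cofactor add0n; congr (_ * _); rewrite -IH.
by congr (\det _); apply/matrixP => i j; rewrite !mxE.
Qed.

Lemma ndet3 F : let f (i j : nat) := F i j in
  ndet 3 F = f 0%N 0%N * (f 1%N 1%N * f 2%N 2%N - f 1%N 2%N * f 2%N 1%N)
           - f 0%N 1%N * (f 1%N 0%N * f 2%N 2%N - f 1%N 2%N * f 2%N 0%N)
           + f 0%N 2%N * (f 1%N 0%N * f 2%N 1%N - f 1%N 1%N * f 2%N 0%N).
Proof.
rewrite /= !big_ord_recl !big_ord0 /= /bump /= !(addn0, add0n, add1n); ring.
Qed.

Lemma ndet4 F : let f (i j : nat) := F i j in
  let d (p q r : nat) :=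
    f 1%N p * (f 2%N q * f 3%N r - f 2%N r * f 3%N q)
    - f 1%N q * (f 2%N p * f 3%N r - f 2%N r * f 3%N p)
    + f 1%N r * (f 2%N p * f 3%N q - f 2%N q * f 3%N p) in
  ndet 4 F = f 0%N 0%N * d 1%N 2%N 3%N - f 0%N 1%N * d 0%N 2%N 3%N
           + f 0%N 2%N * d 0%N 1%N 3%N - f 0%N 3%N * d 0%N 1%N 2%N.
Proof.
rewrite ndetS !big_ord_recl !big_ord0 !ndet3.
rewrite /= /bump /= !(addn0, add0n, add1n); ring.
Qed.

Definition minor (r c : seq nat) F :=
  ndet (size r) (fun i j => F (nth 0%N r i) (nth 0%N c j)).

End LaplaceExpansion.

(** One form of the linearization equation for both settings: with A = K it is the equation at a
    point, with A = K[[t]] its restriction to a formal curve. The derivatives evaluated at 0 are the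
    structure constants. *)
Definition linearizing_at N (E : nat -> nat -> pexpr) (A : comNzRingType)
    (z : nat -> A) (J : nat -> nat -> A) (Y : nat -> A) :=
  forall i j, (i < N)%N -> (j < N)%N ->
    \sum_(k < N) \sum_(l < N) peval z (E k l) * (J i k * J j l)
    = \sum_(k < N) peval (fun=> 0) (pderiv k (E i j)) * Y k.

Section Pfaffians.
Variable A : comNzRingType.
Implicit Types (J : nat -> nat -> A) (Y : nat -> A).

Definition curve_point (i j : nat) (t s : A) : nat -> A :=
  fun k => if k == i then t else if k == j then s else 0.

Lemma saff2_bracket_curve J (t s : A) i j :
  \sum_(k < 5) \sum_(l < 5) peval (curve_point 1 2 t s) (saff2_poisson k l)
     * (J i k * J j l)
  = J i 0%N * (2 * t * J j 1%N - 2 * s * J j 2%N)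
    - (2 * t * J i 1%N - 2 * s * J i 2%N) * J j 0%N
    + 4 * t * s * (J i 3%N * J j 4%N - J i 4%N * J j 3%N).
Proof. rewrite !big_ord_recl !big_ord0 /= /curve_point /=; ring. Qed.

Definition pfaffian (M : nat -> nat -> A) a b c d :=
  M a b * M c d - M a c * M b d + M a d * M b c.

(* The expansion, in terms of the 4x4 minors of J on the rows r, of the Pfaffian
   of J Pi J^T at the point e = t, f = s of the saff(2) structure Pi, where
   Pi = h ^ (2 t e - 2 s f) + 4 t s u ^ v. *)
Definition bivector_minors J (t s : A) r :=
  8 * t ^+ 2 * s * minor r [:: 0; 1; 3; 4]%N J
  - 8 * t * s ^+ 2 * minor r [:: 0; 2; 3; 4]%N J.

(** For a sum of two decomposable bivectors only the cross term survives, here h ^ (2 t e - 2 s f)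
    against 4 t s u ^ v; hence the coefficients 2t . 4ts and -2s . 4ts. *)
Lemma saff2_curve_pfaffian J (t s : A) a b c d :
  let M i j := \sum_(k < 5) \sum_(l < 5)
     peval (curve_point 1 2 t s) (saff2_poisson k l) * (J i k * J j l) in
  pfaffian M a b c d = bivector_minors J t s [:: a; b; c; d].
Proof.
rewrite /= /pfaffian !saff2_bracket_curve.
rewrite /bivector_minors /minor !ndet4 /=; ring.
Qed.

(** In the model {u, v} = {e, u} = {f, v} = 0, so that each of the three Pfaffians retains a single
    product: -u^2, -v^2 and u v. *)
Lemma saff2_curve J Y (t s : A) :
  linearizing_at 5 saff2_poisson (curve_point 1 2 t s) J Y ->
  [/\ Y 3%N ^+ 2 = - bivector_minors J t s [:: 0; 1; 3; 4]%N,
      Y 4%N ^+ 2 = - bivector_minors J t s [:: 0; 2; 3; 4]%N &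
      Y 3%N * Y 4%N = bivector_minors J t s [:: 1; 2; 3; 4]%N].
Proof.
move=> H; rewrite -!saff2_curve_pfaffian /pfaffian !H //.
by rewrite !big_ord_recl !big_ord0 /=; split; ring.
Qed.

(* At x = t e_m, y = mu t e_m one has x . y = t^2 mu, so the hypothesis on mu makes
   Pi the decomposable bivector t (x_p + mu y_p) ^ (x_q + mu y_q). *)
Lemma e3_curve J Y (t mu : A) m : (m < 3)%N -> mu ^+ 2 = t ^+ 2 * mu ->
  linearizing_at 6 e3_poisson (curve_point m m.+3 t (mu * t)) J Y ->
  Y 3%N ^+ 2 = 0.
Proof.
move=> m3 muE H.
(* (m, p, q) is a cyclic permutation of (0, 1, 2), so that {x_p, x_q} = x_m. *)
pose p := ((m.+1) %% 3)%N; pose q := ((m.+2) %% 3)%N.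
have M i j : \sum_(k < 6) \sum_(l < 6)
    peval (curve_point m m.+3 t (mu * t)) (e3_poisson k l) * (J i k * J j l)
  = t * ((J i p + mu * J i p.+3) * (J j q + mu * J j q.+3)
         - (J i q + mu * J i q.+3) * (J j p + mu * J j p.+3)).
  rewrite !big_ord_recl !big_ord0 {}/p {}/q {H}; move: m m3.
  (* The entry {y_p, y_q} is (x . y) x_m = mu t^3, and [muE] rewrites the term t mu^2 of the
     decomposable bivector to it. *)
  by case=> [|[|[|//]]] _; rewrite /= /curve_point /=; ring: muE.
have -> : Y 3%N ^+ 2 = - pfaffian (fun i j => \sum_(k < 6) \sum_(l < 6)
    peval (curve_point m m.+3 t (mu * t)) (e3_poisson k l) * (J i k * J j l))
    1 2 4 5.
  by rewrite /pfaffian !H // !big_ord_recl !big_ord0 /=; ring.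
(* The Pfaffian of a decomposable bivector vanishes: this is the Pluecker relation. *)
rewrite /pfaffian !M; ring.
Qed.

End Pfaffians.

Lemma e3_jacobian_nonunit (K : fieldType) (U : 'M[K]_6) :
  (forall k : 'I_6, U (inord 3) k = 0) -> U \notin unitmx.
Proof.
move=> U0; apply/negP => /mulmxV/matrixP/(_ (inord 3) (inord 3)).
rewrite !mxE eqxx big1 => [/esym/eqP|k _]; last by rewrite U0 mul0r.
by rewrite oner_eq0.
Qed.

Lemma saff2_jacobian_nonunit (K : fieldType) (U : 'M[K]_5)
    (F := fun i j => U (inord i) (inord j)) :
  F 3%N 2%N = 0 -> F 4%N 2%N = 0 ->
  minor [:: 0; 1; 3; 4]%N [:: 0; 1; 3; 4]%N F = 0 ->
  minor [:: 0; 2; 3; 4]%N [:: 0; 1; 3; 4]%N F = 0 ->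
  minor [:: 1; 2; 3; 4]%N [:: 0; 1; 3; 4]%N F = 0 -> U \notin unitmx.
Proof.
move=> F3 F4 m1 m2 m3; rewrite unitmxE unitfE negbK.
have cE (i0 : 'I_5) r : size r = 4 -> 
    (forall i, (i < 4)%N -> nth 0%N r i = bump i0 i) ->
    minor r [:: 0; 1; 3; 4]%N F = 0 -> cofactor U i0 (inord 2) = 0.
  move=> sr rE; rewrite /minor sr -ndetE /cofactor => d0.
  suff -> : row' i0 (col' (inord 2) U) = \matrix_(i < 4, j < 4)
      F (nth 0%N r i) (nth 0%N [:: 0; 1; 3; 4]%N j) by rewrite d0 mulr0.
  apply/matrixP => i j; rewrite !mxE /F; congr (U _ _); apply: val_inj => /=.
    by rewrite rE // inordK // -[bump i0 i]/(nat_of_ord (lift i0 i)).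
  by case: j => -[|[|[|[|//]]]] hj; rewrite /= !inordK.
rewrite (expand_det_col _ (inord 2)); apply/eqP/big1 => i _.
case: i => -[|[|[|[|[|//]]]]] hi.
- by rewrite (cE _ [:: 1; 2; 3; 4]%N) ?mulr0 //; do 4?case.
- by rewrite (cE _ [:: 0; 2; 3; 4]%N) ?mulr0 //; do 4?case.
- by rewrite (cE _ [:: 0; 1; 3; 4]%N) ?mulr0 //; do 4?case.
- rewrite (_ : Ordinal hi = inord 3) ?[U _ _]F3 ?mul0r //.
  by apply: val_inj; rewrite /= inordK.
- rewrite (_ : Ordinal hi = inord 4) ?[U _ _]F4 ?mul0r //.
  by apply: val_inj; rewrite /= inordK.
Qed.

(** * Formal non-linearizability *)

Section TwoVariableCurves.
Variables (K : numFieldType) (N : nat) (i j : 'I_N).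
Hypothesis ij : i != j.
Implicit Type f : fps K N.

(** Exponents of the curve z_i = t, z_j = t^3. With the support {i} the same weights give the
    z_i-axis, so one family of substitutions covers both curves. *)
Definition curve_weight (l : 'I_N) : nat := if l == j then 3 else 1.

Lemma curve_weight_gt0 l : (0 < curve_weight l)%N.
Proof. by rewrite /curve_weight; case: ifP. Qed.

Notation axis_subst := (@curve_subst K N curve_weight [set i]%SET).
Notation cubic_subst := (@curve_subst K N curve_weight [set i; j]%SET).

Lemma axis_subst_coef1 f : axis_subst f (mi_cst 1) = f (mi1 i).
Proof.
have -> : 1%N = curve_weight i by rewrite /curve_weight (negPf ij).
apply: (curve_subst_coef_min curve_weight_gt0); first by rewrite inE.
move=> b; rewrite {2}/curve_weight (negPf ij) => wb /forallP sb.
have b0 l : l != i -> b l = 0%N.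
  by move=> li; have := sb l; rewrite inE li => /eqP.
move: wb; rewrite /weight (bigD1 i) //= big1 ?addn0 => [|l li]; last first.
  by rewrite b0 ?muln0.
rewrite /curve_weight (negPf ij) mul1n => bi.
by apply/ffunP => l; rewrite ffunE; have [->|/b0] := eqVneq l i.
Qed.

(** A monomial containing z_j has weight at least 3, with equality only for z_j itself. Up to degree
    3 the cubic curve therefore differs from the axis by a single coefficient. *)
Lemma cubic_subst_coef f n : (n <= 3)%N ->
  cubic_subst f (mi_cst n) =
  axis_subst f (mi_cst n) + (if n == 3 then f (mi1 j) else 0).
Proof.
move=> n3; rewrite !(@curve_substE _ _ _ _ curve_weight_gt0 4) ?ffunE ?ltnS //.
rewrite (bigID (fun b => box_mi b j == 0%N)) /=; congr (_ + _).
  apply: eq_bigl => b; rewrite -andbA; congr (_ && _).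
  apply/andP/forallP => [[/forallP sb /eqP bj] l|sb].
    apply/implyP; rewrite inE => li; have [->|lj] := eqVneq l j.
      by rewrite bj.
    by apply: (implyP (sb l)); rewrite !inE negb_or li.
  split; last by apply: (implyP (sb j)); rewrite inE eq_sym.
  apply/forallP => l; apply/implyP; rewrite !inE negb_or => /andP[li _].
  by apply: (implyP (sb l)); rewrite inE.
transitivity (\sum_(b : {ffun 'I_N -> 'I_4} | box_mi b == mi1 j)
    if n == 3 then f (mi1 j) else 0); last first.
  rewrite (box_sum_pick (fun=> if n == 3 then f (mi1 j) else 0)) // => l.
  by rewrite ffunE; case: (l == j).
rewrite big_mkcond [RHS]big_mkcond; apply: eq_bigr => b _.
have [->|bj] := eqVneq (box_mi b) (mi1 j).
  rewrite weight_mi1 supported_mi1 !inE eqxx orbT.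
  by rewrite ffunE eqxx /curve_weight eqxx !andbT eq_sym.
case: ifP => // /andP[/andP[/eqP wb _] bj0]; case/eqP: bj.
move: (box_mi b) wb bj0 => {}b wb bj0.
move: wb; rewrite /weight (bigD1 j) //= {1}/curve_weight eqxx => wb.
have [bj1 /eqP] : b j = 1%N /\ (\sum_(l < N | l != j) curve_weight l * b l = 0)%N.
  move: wb bj0 n3; move: (b j) (\sum_(l < N | l != j) _)%N => x' y.
  by case: x' => [|[|x']] //; lia.
rewrite sum_nat_eq0 => /forallP b0; apply/ffunP => l; rewrite ffunE.
have [->//|lj] := eqVneq l j.
by have := implyP (b0 l) lj; rewrite /curve_weight (negPf lj) mul1n => /eqP.
Qed.

(** A series that vanishes on the axis has order at least 3 on the curve that leaves it by t^3, and
    its t^3 coefficient is the derivative along z_j at 0. *)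
Lemma cubic_subst_order f : axis_subst f = 0 ->
  order_ge 3 (cubic_subst f) /\ cubic_subst f (mi_cst 3) = f (mi1 j).
Proof.
move=> f0; split=> [k k3|]; rewrite cubic_subst_coef ?f0 ?eqxx ?add0r //.
  by case: eqP k3 => // ->.
exact: ltnW.
Qed.

End TwoVariableCurves.

Section FormalPolynomials.
Variables (K : numFieldType) (N : nat).

Definition fps_coordinate (k : nat) : fps K N := oapp (@fps_var K N) 0 (insub k).

Definition formal_structure (E : nat -> nat -> pexpr) (i j : 'I_N) : fps K N :=
  peval fps_coordinate (E i j).

Lemma fps_pd0 (l : 'I_N) : fps_pd (0 : fps K N) l = 0.
Proof.
by apply/funext => m; rewrite /fps_pd -[X in X *+ _]/(0 : K) mul0rn.
Qed.

Lemma fps_pd_peval E (l : 'I_N) :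
  fps_pd (peval fps_coordinate E) l = peval fps_coordinate (pderiv l E).
Proof.
elim: E => [n|k|E IHE F IHF|E IHE F IHF|E IHE] /=.
- elim: n => [|n IH]; first exact: fps_pd0.
  by rewrite -natr1 fps_pdD fps_pd1 addr0.
- rewrite /fps_coordinate; case: insubP => [u _ <-|kN] /=.
    by rewrite fps_pd_var.
  have -> : (k == l) = false by apply: contraNF kN => /eqP ->; apply: ltn_ord.
  by rewrite fps_pd0.
- by rewrite fps_pdD IHE IHF.
- by rewrite fps_pdM IHE IHF.
- by rewrite fps_pdN IHE.
Qed.

Lemma peval_fps_coef0 E :
  peval fps_coordinate E (mi0 N) = peval (fun=> 0 : K) E.
Proof.
rewrite (peval_morph (h := fun f : fps K N => f (mi0 N))) //.
- apply: eq_peval => k /=; rewrite /fps_coordinate.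
  case: insubP => [u _ _|//]; rewrite /= /fps_var.
  by case: eqP => // /ffunP/(_ u); rewrite !ffunE eqxx.
- exact: fps_coef0M.
by rewrite /GRing.one /= /fps_one eqxx.
Qed.

Lemma formal_linear_partE E (i j k : 'I_N) :
  formal_linear_part (formal_structure E) i j k
  = peval (fun=> 0) (pderiv k (E i j)).
Proof.
rewrite -peval_fps_coef0 -fps_pd_peval /fps_pd.
have -> : miadd (mi0 N) (mi1 k) = mi1 k by apply/ffunP => l; rewrite !ffunE.
by rewrite ffunE.
Qed.

Lemma formal_structure_poisson U : pjacobi N (antisymmetrize U) ->
  formal_poisson (formal_structure (antisymmetrize U)).
Proof.
move=> J; split=> [i j m|i j k m].
  by rewrite /formal_structure peval_antisymmetrize.
have := congr1 (fun f : fps K N => f m) (J _ fps_coordinate i j k).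
rewrite fps_sumE => e; apply: (etrans _ e); apply: eq_bigr => l _.
by rewrite /formal_structure -!fps_pd_peval.
Qed.

(** Evaluated at zero series, an expression is a constant series, and multiplying by it scales
    coefficients by its value in K. This identifies the structure constants seen in both rings. *)
Lemma peval0_fps_scale E (f : fps K N) m :
  (peval (fun=> 0) E * f) m = peval (fun=> 0) E * f m.
Proof.
elim: E f => [n|k|E IHE F IHF|E IHE F IHF|E IHE] f /=.
- rewrite !mulr_natl; elim: n => [|n IH]; first by rewrite !mulr0n.
  by rewrite !mulrSr fps_addE IH.
- by rewrite !mul0r.
- by rewrite !mulrDl fps_addE IHE IHF.
- by rewrite -!mulrA IHE IHF.
- by rewrite !mulNr -IHE.
Qed.

End FormalPolynomials.

Section FormalLinearization.
Variables (K : numFieldType) (n : nat).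
Let N := n.+1.
Variables (E : nat -> nat -> pexpr) (phi : 'I_N -> fps K N).
Hypothesis phi_lin : forall i j m,
  \sum_(k < N) \sum_(l < N) fps_mul (formal_structure K E k l)
      (fps_mul (fps_pd (phi i) k) (fps_pd (phi j) l)) m
  = \sum_(k < N) formal_linear_part (formal_structure K E) i j k * phi k m.
Variables (w : 'I_N -> nat) (v : {set 'I_N}).
Hypothesis w_gt0 : forall l, (0 < w l)%N.
Notation T := (@curve_subst K N w v).

(** The linearization equation, read as an identity of series, is transported by the morphism T. The
    partial derivatives are taken before restriction, so no chain rule is involved. *)
Lemma formal_linearizing_at (z : nat -> fps K 1) :
  (forall k, (k < N)%N -> z k = if inord k \in v
      then fps_var K (ord0 : 'I_1) ^+ w (inord k) else 0) ->
  (forall k, (N <= k)%N -> z k = 0) ->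
  linearizing_at N E z (fun i k => T (fps_pd (phi (inord i)) (inord k)))
    (fun k => T (phi (inord k))).
Proof.
move=> zE z0 i j iN jN.
have TD : {morph T : x y / x + y} by exact: curve_substD.
have TM : {morph T : x y / x * y} by exact: curve_substM.
have T1 := curve_subst1 K w v.
have T0 : T 0 = 0 by apply: (addrI (T 0)); rewrite -TD !addr0.
have Tsum (F : 'I_N -> fps K N) : T (\sum_k F k) = \sum_k T (F k).
  exact: (big_morph T TD T0).
have Tz : T \o @fps_coordinate K N =1 z.
  move=> k /=; rewrite /fps_coordinate; case: insubP => [u kN uk|] /=.
    by rewrite curve_subst_var // -uk zE ?uk // -uk inord_val.
  by rewrite -leqNgt => /z0 ->.
have e : \sum_(k < N) \sum_(l < N) formal_structure K E k l
      * (fps_pd (phi (inord i)) k * fps_pd (phi (inord j)) l)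
    = \sum_(k < N) peval (fun=> 0) (pderiv k (E i j)) * phi k.
  apply/funext => m; rewrite !fps_sumE.
  under eq_bigr => k _ do rewrite fps_sumE.
  rewrite -[LHS]/(\sum_(k < N) \sum_(l < N) fps_mul (formal_structure K E k l)
      (fps_mul (fps_pd (phi (inord i)) k) (fps_pd (phi (inord j)) l)) m).
  rewrite phi_lin; apply: eq_bigr => k _.
  by rewrite formal_linear_partE !inordK // peval0_fps_scale.
move/(congr1 T): e; rewrite !Tsum => e.
transitivity (\sum_(k < N) T (peval (fun=> 0) (pderiv k (E i j)) * phi k)).
  rewrite -e; apply: eq_bigr => k _; rewrite Tsum; apply: eq_bigr => l _.
  rewrite !TM !inord_val /formal_structure (peval_morph (h := T)) //.
  by congr (_ * _); apply: eq_peval => x; rewrite Tz.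
apply: eq_bigr => k _; rewrite TM inord_val (peval_morph (h := T)) //.
by congr (_ * _); apply: eq_peval => x /=.
Qed.

End FormalLinearization.

Lemma ndet_morph (A B : comNzRingType) (h : A -> B) n (F : nat -> nat -> A) :
  {morph h : x y / x + y} -> {morph h : x y / x * y} -> h 1 = 1 ->
  h (ndet n F) = ndet n (fun i j => h (F i j)).
Proof.
move=> hD hM h1; have h0 : h 0 = 0 by apply: (addrI (h 0)); rewrite -hD !addr0.
have hN1 : h (-1) = -1 by apply: (addrI (h 1)); rewrite -hD h1 !subrr h0.
elim: n F => //= n IH F; rewrite (big_morph h hD h0).
apply: eq_bigr => k _; rewrite !hM IH; congr (_ * (_ * _)).
by elim: (nat_of_ord k) => // p IHp; rewrite !exprS hM IHp hN1.
Qed.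

(** * The formal obstruction for e(3) and saff(2) *)

Section FormalNonlinearizable.
Variable K : numFieldType.
Let tau : fps K 1 := fps_var K ord0.

Lemma e3_not_formally_linearizable :
  ~ formally_linearizable (formal_structure K e3_poisson : 'I_6 -> _).
Proof.
case=> phi [[phi0 phiU] phi_lin]; move: phiU; apply/negP.
apply: e3_jacobian_nonunit.
(* Row 3 is that of y_1; its entries are treated in pairs, the derivatives along x_m and y_m. *)
suff h (m : 'I_3) : phi (inord 3) (mi1 (inord m)) = 0 /\
    phi (inord 3) (mi1 (inord m.+3)) = 0.
  case=> k hk; rewrite mxE.
  have [k3|k3] := ltnP k 3.
    rewrite (_ : Ordinal hk = inord k); first exact: (h (Ordinal k3)).1.
    by apply: val_inj; rewrite /= inordK.
  have k3' : (k - 3 < 3)%N by rewrite ltn_subLR.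
  have e : (k - 3).+3 = k by rewrite -[LHS]addn3 subnK.
  rewrite (_ : Ordinal hk = inord (k - 3).+3); first exact: (h (Ordinal k3')).2.
  by apply: val_inj; rewrite /= e inordK.
case: m => m m3 /=.
have m6 : (m < 6)%N by apply: leq_trans m3 _.
pose i : 'I_6 := inord m; pose j : 'I_6 := inord m.+3.
have ij : i != j by rewrite -val_eqE /= !inordK // ltn_eqF // -addn3 -ltn_subLR // subnn.
have wg := @curve_weight_gt0 6 j.
have Ya : curve_subst (curve_weight j) [set i]%SET (phi (inord 3)) = 0.
  apply: fps1_sqr_eq0.
  apply: (@e3_curve _ _ (fun k => curve_subst _ _ (phi (inord k))) tau 0 m m3).
    by rewrite expr0n mulr0.
  apply: (formal_linearizing_at phi_lin wg) => k kN; rewrite /curve_point.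
    rewrite inE -val_eqE /= !inordK //; case: ifP => km.
      by rewrite /curve_weight (eqP km) -/i (negPf ij).
    by rewrite mul0r if_same.
  by rewrite mul0r if_same gtn_eqF // (leq_trans m6 kN).
have Yc : curve_subst (curve_weight j) [set i; j]%SET (phi (inord 3)) = 0.
  apply: fps1_sqr_eq0.
  apply: (@e3_curve _ _ (fun k => curve_subst _ _ (phi (inord k))) tau
    (tau ^+ 2) m m3); first exact: expr2.
  apply: (formal_linearizing_at phi_lin wg) => k kN; rewrite /curve_point.
    rewrite !inE -!val_eqE /= !inordK //; case: ifP => km.
      by rewrite /curve_weight (eqP km) -/i (negPf ij).
    case: ifP => //= kj; first by rewrite /curve_weight (eqP kj) -/j eqxx -exprSr.
  by rewrite !gtn_eqF // ?(leq_trans m6 kN) // (leq_trans _ kN).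
split; first by rewrite -(axis_subst_coef1 ij) Ya.
by have [_ <-] := cubic_subst_order ij Ya; rewrite Yc.
Qed.

Lemma saff2_not_formally_linearizable :
  ~ formally_linearizable (formal_structure K saff2_poisson : 'I_5 -> _).
Proof.
case=> phi [[phi0 phiU] phi_lin]; move: phiU; apply/negP.
have wg := @curve_weight_gt0 5.
pose J (j : 'I_5) v r k : fps K 1 :=
  curve_subst (curve_weight j) v (fps_pd (phi (inord r)) (inord k)).
pose Y (j : 'I_5) v k : fps K 1 := curve_subst (curve_weight j) v (phi (inord k)).
have core (j : 'I_5) (v : {set 'I_5}) (t s : fps K 1) :
    (forall k, (k < 5)%N -> curve_point 1 2 t s k =
      if inord k \in v then tau ^+ curve_weight j (inord k) else 0) ->
    [/\ Y j v 3%N ^+ 2 = - bivector_minors (J j v) t s [:: 0; 1; 3; 4]%N,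
      Y j v 4%N ^+ 2 = - bivector_minors (J j v) t s [:: 0; 2; 3; 4]%N &
      Y j v 3%N * Y j v 4%N = bivector_minors (J j v) t s [:: 1; 2; 3; 4]%N].
  move=> zE; apply: saff2_curve; apply: (formal_linearizing_at phi_lin (wg j)) => //.
  by case=> [|[|[|k]]].
pose e : 'I_5 := inord 1; pose f : 'I_5 := inord 2.
have ef : e != f by rewrite -val_eqE /= !inordK.
have fe : f != e by rewrite eq_sym.
have zero_minors j v (t s : fps K 1) r : t * s = 0 -> bivector_minors (J j v) t s r = 0.
  move=> ts; rewrite /bivector_minors; set a := minor _ _ _; set b := minor _ _ _.
  have -> : 8 * t ^+ 2 * s * a - 8 * t * s ^+ 2 * b
    = t * s * (8 * t * a - 8 * s * b) by ring.
  by rewrite ts mul0r.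
have [Ye3 Ye4] : Y f [set e]%SET 3%N = 0 /\ Y f [set e]%SET 4%N = 0.
  have [|+ + _] := core f [set e]%SET tau 0.
    case=> [|[|[|[|[|//]]]]] _; rewrite /curve_point inE -val_eqE /= !inordK //.
    by rewrite /curve_weight -val_eqE /= !inordK.
  by rewrite !zero_minors ?mulr0 // oppr0 => /fps1_sqr_eq0-> /fps1_sqr_eq0->.
(* The roles of e and f are exchanged in the weights, so that f has weight 1 on its own axis. *)
have [Yf3 Yf4] : Y e [set f]%SET 3%N = 0 /\ Y e [set f]%SET 4%N = 0.
  have [|+ + _] := core e [set f]%SET 0 tau.
    case=> [|[|[|[|[|//]]]]] _; rewrite /curve_point inE -val_eqE /= !inordK //.
    by rewrite /curve_weight -val_eqE /= !inordK.
  by rewrite !zero_minors ?mul0r // oppr0 => /fps1_sqr_eq0-> /fps1_sqr_eq0->.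
have [|Y33 Y44 Y34] := core f [set e; f]%SET tau (tau ^+ 3).
  case=> [|[|[|[|[|//]]]]] _; rewrite /curve_point !inE -!val_eqE /= !inordK //;
    by rewrite /curve_weight -val_eqE /= !inordK.
have [oY3 _] := cubic_subst_order ef Ye3.
have [oY4 _] := cubic_subst_order ef Ye4.
have coef5 r : bivector_minors (J f [set e; f]%SET) tau (tau ^+ 3) r (mi_cst 5)
    = 8 * minor r [:: 0; 1; 3; 4]%N (fun r k => phi (inord r) (mi1 (inord k))).
  rewrite /bivector_minors; set a := minor _ _ _; set b := minor _ _ _.
  (* The second minor comes with tau (tau^3)^2 = tau^7, so the coefficient of tau^5 sees the first
     minor alone. *)
  have -> : 8 * tau ^+ 2 * tau ^+ 3 * a - 8 * tau * (tau ^+ 3) ^+ 2 * b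
    = tau ^+ 5 * (8 * a - tau ^+ 2 * (8 * b)) by ring.
  have [_ ->] := order_varXn 5 (8 * a - tau ^+ 2 * (8 * b)).
  have c0M (x y : fps K 1) : (x * y) (mi_cst 0) = x (mi_cst 0) * y (mi_cst 0).
    exact: (order_mul (p := 0) (q := 0) _ _).2.
  have c01 : (1 : fps K 1) (mi_cst 0) = 1.
    by rewrite -(expr0 tau) coef_varXn ffunE.
  have c0n n : (n%:R : fps K 1) (mi_cst 0) = n%:R.
    by elim: n => // n IH; rewrite -!natr1 fps_addE IH c01.
  rewrite -[LHS]/((8 * a) (mi_cst 0) - (tau ^+ 2 * (8 * b)) (mi_cst 0)).
  rewrite !c0M coef_varXn ffunE mul0r subr0 c0n; congr (_ * _).
  rewrite /a /minor (ndet_morph (h := fun x : fps K 1 => x (mi_cst 0))) //.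
  congr (ndet _ _); apply/funext => p; apply/funext => q.
  rewrite /J (curve_subst_coef0 _ (wg f)) /fps_pd ffunE mulr1n.
  by congr (phi _ _); apply/ffunP => l; rewrite !ffunE.
(* As 3 + 3 > 5, products of components of Y do not reach the leading order of the Pfaffian. *)
have zero6 (F G : fps K 1) : order_ge 3 F -> order_ge 3 G -> (F * G) (mi_cst 5) = 0.
  by move=> oF oG; have [h _] := order_mul oF oG; apply: h.
have minor0 r : bivector_minors (J f [set e; f]%SET) tau (tau ^+ 3) r (mi_cst 5) = 0
    -> minor r [:: 0; 1; 3; 4]%N (fun r k => phi (inord r) (mi1 (inord k))) = 0.
  by rewrite coef5 => /eqP; rewrite mulf_eq0 pnatr_eq0 /= => /eqP.
have sqr0 (F G : fps K 1) : order_ge 3 F -> F ^+ 2 = - G -> G (mi_cst 5) = 0.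
  move=> oF FG; have := zero6 _ _ oF oF; rewrite -expr2 FG.
  by move/eqP; rewrite -[X in X == _]/(- G (mi_cst 5)) oppr_eq0 => /eqP.
have Ue : (fun i j => (\matrix_(i < 5, k < 5) phi i (mi1 k)) (inord i) (inord j))
  = (fun r k => phi (inord r) (mi1 (inord k))).
  by apply/funext => p; apply/funext => q; rewrite mxE.
apply: saff2_jacobian_nonunit.
- by rewrite mxE -/f -(axis_subst_coef1 fe) [curve_subst _ _ _]Yf3.
- by rewrite mxE -/f -(axis_subst_coef1 fe) [curve_subst _ _ _]Yf4.
- by rewrite Ue; apply: minor0; apply: sqr0 Y33.
- by rewrite Ue; apply: minor0; apply: sqr0 Y44.
- by rewrite Ue; apply: minor0; rewrite -Y34 zero6.
Qed.

End FormalNonlinearizable.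

(** * Structure constants *)

Section SemidirectBasis.
Variables (K : fieldType) (n : nat) (h : {vspace 'M[K]_n}).
Hypothesis hC : forall A B, A \in h -> B \in h -> commutator A B \in h.
Variables (N : nat) (m : 'I_N -> 'M[K]_n) (w : 'I_N -> 'cV[K]_n).
Variable c : 'I_N -> 'I_N -> 'I_N -> K.

(** Independence, generation and brackets are stated for pairs of plain matrices, which confines the
    subspace type of [h] and the projection [vsproj] to this proof. *)
Lemma structure_constants_semidirect :
  (forall k, m k \in h) ->
  (forall a : 'I_N -> K, \sum_k a k *: m k = 0 -> \sum_k a k *: w k = 0 ->
     forall k, a k = 0) ->
  (forall A v, A \in h -> exists a : 'I_N -> K,
     A = \sum_k a k *: m k /\ v = \sum_k a k *: w k) ->
  (forall i j, commutator (m i) (m j) = \sum_k c i j k *: m k) ->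
  (forall i j, m i *m w j - m j *m w i = \sum_k c i j k *: w k) ->
  structure_constants (semidirect hC) c.
Proof.
move=> mh indep gen cm cw.
pose e k : semidirect hC := (vsproj h (m k), w k).
have sumE (a : 'I_N -> K) : \sum_k a k *: e k
    = (vsproj h (\sum_k a k *: m k), \sum_k a k *: w k) :> semidirect hC.
  rewrite linear_sum /=; elim/big_rec3: _ => [|k x y z _ ->]; first by [].
  by rewrite /e linearZ.
exists [tuple e k | k < N]; split; last first.
  move=> i j; under eq_bigr => k _ do rewrite tnth_mktuple.
  rewrite !tnth_mktuple sumE /= /semidirect_bracket /=.
  by rewrite !vsprojK // cm cw.
have eE (i : 'I_N) : [tuple e k | k < N]`_i = e i by rewrite -tnth_nth tnth_mktuple.
apply/andP; split; last first.
  apply/freeP => a; under eq_bigr => k _ do rewrite eE.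
  rewrite sumE => -[/(congr1 vsval)]; rewrite linear0.
  rewrite vsprojK => [am aw|]; first exact: indep.
  by apply: memv_suml => k _; apply: memvZ.
apply/eqP/vspaceP => -[A v]; rewrite memvf.
have [a [Aa va]] := gen _ v (subvsP A).
have -> : (A, v) = \sum_k a k *: e k by rewrite sumE -Aa -va vsvalK.
apply: memv_suml => k _; apply: memvZ; apply: memv_span.
by apply/tnthP; exists k; rewrite tnth_mktuple.
Qed.

End SemidirectBasis.

Lemma entry_matrix_sum (K : fieldType) N p q (F : nat -> nat -> nat -> K)
    (a : 'I_N -> K) (i : 'I_p) (j : 'I_q) :
  (\sum_(k < N) a k *: (\matrix_(i < p, j < q) F k i j)) i j
  = \sum_(k < N) a k * F k i j.
Proof. by rewrite summxE; apply: eq_bigr => k _; rewrite !mxE. Qed.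

Section ConcreteBases.
Variable K : numFieldType.

(** The standard triple h = diag(1, -1), e, f of sl(2), extended by 0 at the indices of the
    translations. *)
Definition saff2_linear_basis (k i j : nat) : K :=
  match k, i, j with
  | 0, 0, 0 => 1%R | 0, 1, 1 => (-1)%R | 1, 0, 1 => 1%R | 2, 1, 0 => 1%R | _, _, _ => 0%R
  end%N.

(** The infinitesimal rotations: for k < 3 the matrix k is the cross product with the unit vector
    e_k on the left. *)
Definition e3_linear_basis (k i j : nat) : K :=
  match k, i, j with
  | 0, 1, 2 => (-1)%R | 0, 2, 1 => 1%R
  | 1, 0, 2 => 1%R | 1, 2, 0 => (-1)%R
  | 2, 0, 1 => (-1)%R | 2, 1, 0 => 1%R | _, _, _ => 0%R
  end%N.

Definition translation_basis n (k i j : nat) : K := (k == n + i)%N%:R.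

Lemma saff2_structure_constants : structure_constants (saff2 K)
  (fun i j k : 'I_5 => peval (fun=> 0) (pderiv k (saff2_poisson i j))).
Proof.
apply: (@structure_constants_semidirect _ _ _ (@sl_commutator K 2) 5
  (fun k => \matrix_(i, j) saff2_linear_basis k i j)
  (fun k => \matrix_(i, j) translation_basis 3 k i j)).
- case=> k hk; rewrite mem_sl /mxtrace !big_ord_recl big_ord0 !mxE.
  by case: k hk => [|[|[|[|[|//]]]]] _ /=; apply/eqP; ring.
- move=> a am aw [k hk].
  have am' i j := congr1 (fun A : 'M[K]_2 => A i j) am.
  have aw' i j := congr1 (fun A : 'cV[K]_2 => A i j) aw.
  move: (am' (inord 0) (inord 0)) (am' (inord 0) (inord 1))
    (am' (inord 1) (inord 0)) (aw' (inord 0) ord0) (aw' (inord 1) ord0).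
  rewrite !entry_matrix_sum !mxE !inordK // !big_ord_recl !big_ord0 /=.
  rewrite /translation_basis /=.
  rewrite !(mulr0, mulr1, add0r, addr0) => a0 a1 a2 a3 a4.
  case: k hk => [|[|[|[|[|//]]]]] hk; [rewrite -a0|rewrite -a1|rewrite -a2|
    rewrite -a3|rewrite -a4]; congr (a _); exact: val_inj.
- move=> A v; rewrite mem_sl /mxtrace !big_ord_recl big_ord0 addr0 => /eqP tr0.
  exists (fun k => nth 0 [:: A (inord 0) (inord 0); A (inord 0) (inord 1);
    A (inord 1) (inord 0); v (inord 0) ord0; v (inord 1) ord0] k).
  have o0 : inord 0 = ord0 :> 'I_2 by apply: val_inj; rewrite /= inordK.
  have o1 : inord 1 = lift ord0 ord0 :> 'I_2 by apply: val_inj; rewrite /= inordK.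
  split; apply/matrixP => i j; rewrite entry_matrix_sum !big_ord_recl big_ord0.
    case: (unliftP ord0 i) => [i'|] ->; case: (unliftP ord0 j) => [j'|] ->;
      rewrite ?ord1 o0 o1 /=; try ring.
    by rewrite -[LHS](addKr (A ord0 ord0)) tr0; ring.
  by rewrite [j]ord1; case: (unliftP ord0 i) => [i'|] ->;
    rewrite ?ord1 o0 o1 /translation_basis /=; ring.
- case=> i hi [j hj]; apply/matrixP => -[a ha] [b hb].
  rewrite entry_matrix_sum !mxE !big_ord_recl !big_ord0 !mxE /=.
  move: i j a b hi hj ha hb; do 2![case=> [|[|[|[|[|//]]]]]];
    do 2![case=> [|[|//]]] => * /=; ring.
- case=> i hi [j hj]; apply/matrixP => -[a ha] [[|//] hb].
  rewrite entry_matrix_sum !mxE !big_ord_recl !big_ord0 !mxE /= /translation_basis.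
  move: i j a hi hj ha; do 2![case=> [|[|[|[|[|//]]]]]];
    do 1![case=> [|[|//]]] => * /=; ring.
Qed.

Lemma e3_structure_constants : structure_constants (e3 K)
  (fun i j k : 'I_6 => peval (fun=> 0) (pderiv k (e3_poisson i j))).
Proof.
apply: (@structure_constants_semidirect _ _ _ (@so_commutator K 3) 6
  (fun k => \matrix_(i, j) e3_linear_basis k i j)
  (fun k => \matrix_(i, j) translation_basis 3 k i j)).
- case=> k hk; rewrite mem_so; apply/eqP/matrixP => -[a ha] [b hb]; rewrite !mxE.
  by move: k a b hk ha hb; case=> [|[|[|[|[|[|//]]]]]];
    do 2![case=> [|[|[|//]]]] => * /=; ring.
- move=> a am aw [k hk].
  have am' i j := congr1 (fun A : 'M[K]_3 => A i j) am.
  have aw' i j := congr1 (fun A : 'cV[K]_3 => A i j) aw.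
  move: (am' (inord 2) (inord 1)) (am' (inord 0) (inord 2))
    (am' (inord 1) (inord 0)) (aw' (inord 0) ord0) (aw' (inord 1) ord0)
    (aw' (inord 2) ord0).
  rewrite !entry_matrix_sum !mxE !inordK // !big_ord_recl !big_ord0 /=.
  rewrite /translation_basis /=.
  rewrite !(mulr0, mulr1, add0r, addr0) => a0 a1 a2 a3 a4 a5.
  case: k hk => [|[|[|[|[|[|//]]]]]] hk; [rewrite -a0|rewrite -a1|rewrite -a2|
    rewrite -a3|rewrite -a4|rewrite -a5]; congr (a _); exact: val_inj.
- move=> A v; rewrite mem_so => /eqP/matrixP At.
  have Aa i j : A j i = - A i j by have := At i j; rewrite !mxE.
  (* Antisymmetry gives 2 A_ii = 0, and the characteristic is 0. *)
  have A0 i : A i i = 0.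
    by apply/eqP; rewrite -[_ == 0](mulrn_eq0 _ 2) mulr2n {1}Aa addNr.
  exists (fun k => nth 0 [:: A (inord 2) (inord 1); A (inord 0) (inord 2);
    A (inord 1) (inord 0); v (inord 0) ord0; v (inord 1) ord0;
    v (inord 2) ord0] k).
  have inE3 (i : 'I_3) : i = inord i by rewrite inord_val.
  split; apply/matrixP => -[i hi] [j hj]; rewrite entry_matrix_sum !big_ord_recl big_ord0.
    rewrite [Ordinal hi]inE3 [Ordinal hj]inE3 /=.
    move: i j hi hj; do 2![case=> [|[|[|//]]]] => * /=;
      rewrite ?A0 !inordK //=; (ring || (rewrite Aa; ring)).
  rewrite [Ordinal hi]inE3 [Ordinal hj]ord1 /translation_basis /=.
  by move: i hi; case=> [|[|[|//]]] => * /=; rewrite !inordK //=; ring.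
- case=> i hi [j hj]; apply/matrixP => -[a ha] [b hb].
  rewrite entry_matrix_sum !mxE !big_ord_recl !big_ord0 !mxE /=.
  move: i j a b hi hj ha hb; do 2![case=> [|[|[|[|[|[|//]]]]]]];
    do 2![case=> [|[|[|//]]]] => * /=; ring.
- case=> i hi [j hj]; apply/matrixP => -[a ha] [[|//] hb].
  rewrite entry_matrix_sum !mxE !big_ord_recl !big_ord0 !mxE /= /translation_basis.
  move: i j a hi hj ha; do 2![case=> [|[|[|[|[|[|//]]]]]]];
    do 1![case=> [|[|[|//]]]] => * /=; ring.
Qed.

End ConcreteBases.

(** * Non-linearizability of germs *)

Section RowVectorNeighbourhoods.
Variables (K : numFieldType) (N : nat).

Lemma near0_rowP (P : 'rV[K]_N -> Prop) :
  (\forall x \near (0 : 'rV[K]_N), P x) <->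
  exists2 d : K, 0 < d & forall x : 'rV[K]_N, (forall i, `|x 0 i| < d) -> P x.
Proof.
split=> [/nbhs_ballP[d /= d0 dP]|[d d0 dP]].
  exists d => // x xd; apply: dP; split => // i j.
  by rewrite ord1 /ball /= mxE sub0r normrN.
apply/nbhs_ballP; exists d => //= x [_ xd]; apply: dP => i.
by have := xd 0 i; rewrite /ball /= mxE sub0r normrN.
Qed.

Definition axis (i : 'I_N) : 'rV[K]_N := delta_mx 0 i.

(* The only regularity that the obstruction uses; smooth and analytic germs
   both have it. *)
Definition C1_at0 (f : 'rV[K]_N -> K) := forall k e, 0 < e ->
  exists2 d : K, 0 < d & forall x : 'rV[K]_N, (forall i, `|x 0 i| < d) ->
    `|pd f k x - pd f k 0| <= e /\
    forall s, `|s| < d -> `|f (x + s *: axis k) - f x - s * pd f k 0| <= e * `|s|.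

Definition curve (i j : 'I_N) (t s : K) : 'rV[K]_N := t *: axis i + s *: axis j.

Lemma curve_entry i j t s k : i != j -> curve i j t s 0 k =
  if k == i then t else if k == j then s else 0.
Proof.
move=> ij; rewrite !mxE eqxx /=; have [->|ki] := eqVneq k i.
  by rewrite (negPf ij) mulr0 addr0 mulr1.
by case: eqP => _; rewrite ?mulr1 !mulr0 add0r.
Qed.

Lemma near0_curve (P : 'rV[K]_N -> Prop) i j (s : K -> K) : i != j ->
  s @ 0^' --> 0 -> (\forall x \near (0 : 'rV[K]_N), P x) ->
  \forall t \near 0^', P (curve i j t (s t)).
Proof.
move=> ij s0 /near0_rowP[d d0 dP]; near=> t; apply: dP => k.
rewrite curve_entry //; case: ifP => _; first by near: t; exact: dnbhs0_lt.
case: ifP => _; last by rewrite normr0.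
by near: t; have /cvgr0_norm_lt := s0; apply.
Unshelve. all: by end_near. Qed.

Lemma near0_axis (P : 'rV[K]_N -> Prop) i :
  (\forall x \near (0 : 'rV[K]_N), P x) -> \forall t \near 0^', P (t *: axis i).
Proof.
move=> /near0_rowP[d d0 dP]; near=> t; apply: dP => k.
rewrite !mxE eqxx /=; case: (k == i); rewrite ?mulr1 ?mulr0 ?normr0 //.
by near: t; exact: dnbhs0_lt.
Unshelve. all: by end_near. Qed.

Lemma cvg_expr0 n : (fun t : K => t ^+ n.+1) @ 0^' --> (0 : K).
Proof.
have id0 : (fun t : K => t) @ 0^' --> (0 : K) by move=> A /nbhs_dnbhs.
elim: n => [|n IH]; first exact: id0.
have := @cvgM _ _ _ (dnbhs_filter _) _ _ _ _ id0 IH; rewrite mulr0.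
have -> // : (fun t : K => t) \* (fun t => t ^+ n.+1) = (fun t => t ^+ n.+2).
by apply/funext => t; rewrite [RHS]exprS.
Qed.

Lemma pd_axis0 f i : C1_at0 f -> f 0 = 0 ->
  (\forall t \near (0 : K)^', f (t *: axis i) = 0) -> pd f i 0 = 0.
Proof.
move=> Cf f0 fi; apply/eqP/negPn/negP => a0.
(* With half the derivative as tolerance, a zero at t on the axis would give |a| |t| <= |a| |t| /
   2. *)
have e0 : 0 < `|pd f i 0| / 2 by rewrite divr_gt0 ?normr_gt0.
have [d d0 dP] := Cf i _ e0.
have [t [t0 td ft]] : exists t : K, [/\ t != 0, `|t| < d & f (t *: axis i) = 0].
  near (0 : K)^' => t; exists t; split; near: t.
  - exact: nbhs_dnbhs_neq.
  - exact: dnbhs0_lt.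
  - exact: fi.
have [|_ /(_ t td)] := dP 0; first by move=> k; rewrite mxE normr0.
rewrite add0r ft f0 subrr sub0r normrN normrM mulrC.
rewrite ler_pM2r ?normr_gt0 // ler_pdivlMr ?ltr0n //.
by rewrite ger_pMr ?normr_gt0 // (ler_nat K 2 1).
Unshelve. all: by end_near. Qed.

(** The increment t^3 along z_j starts from a base point that moves with t. Differentiability at 0
    alone would leave an error o(t); strict differentiability makes it o(t^3). *)
Lemma cvg_curve_quotient f i j : C1_at0 f ->
  (\forall t \near (0 : K)^', f (t *: axis i) = 0) ->
  (fun t => f (curve i j t (t ^+ 3)) / t ^+ 3) @ 0^' --> pd f j 0.
Proof.
move=> Cf fi; apply/cvgrPdist_le => e e0; have [d d0 dP] := Cf j _ e0.
near=> t.
have t0 : t != 0 by near: t; exact: nbhs_dnbhs_neq.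
have t3 : t ^+ 3 != 0 by rewrite expf_neq0.
have [|_ /(_ (t ^+ 3))] := dP (t *: axis i).
  move=> k; rewrite !mxE eqxx /=; case: (k == i); rewrite ?mulr1 ?mulr0 ?normr0 //.
  by near: t; exact: dnbhs0_lt.
have -> : f (t *: axis i) = 0 by near: t.
rewrite subr0 -/(curve i j t _) => h.
have {}h := h _; rewrite -(ler_pM2r (_ : 0 < `|t ^+ 3|)) ?normr_gt0 //.
rewrite -normrM mulrBl divfK // distrC [_ * t ^+ 3]mulrC.
apply: h; near: t.
by have /cvgr0_norm_lt := @cvg_expr0 2; apply.
Unshelve. all: by end_near. Qed.

Lemma cvg_curve_pd f i j k : i != j -> C1_at0 f ->
  (fun t => pd f k (curve i j t (t ^+ 3))) @ 0^' --> pd f k 0.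
Proof.
move=> ij Cf; apply/cvgrPdistC_le => e e0; have [d d0 dP] := Cf k _ e0.
suff : \forall x \near (0 : 'rV[K]_N), `|pd f k x - pd f k 0| <= e.
  by apply: near0_curve => //; exact: cvg_expr0.
by apply/near0_rowP; exists d => // x /dP[].
Qed.

End RowVectorNeighbourhoods.

Lemma cvg_ndet (K : numFieldType) (T : Type) (F : set_system T) {FF : Filter F} n
    (G : nat -> nat -> T -> K) (l : nat -> nat -> K) :
  (forall i j, G i j @ F --> l i j) ->
  (fun t => ndet n (fun i j => G i j t)) @ F --> ndet n l.
Proof.
elim: n G l => [|n IH] G l Gl /=; first exact: cvg_cst.
apply: (cvg_big (op := +%R)) => [|k _]; first exact: add_continuous.
apply: cvgM; first exact: Gl.
apply: cvgM; first exact: cvg_cst.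
by apply: (IH (fun i j => G i.+1 (bump k j)) (fun i j => l i.+1 (bump k j))).
Qed.

Section PointwisePolynomials.
Variables (K : numFieldType) (N : nat).
Implicit Type x : 'rV[K]_N.

(** The default 0 beyond N agrees with [curve_point], so that the two can be identified at every
    natural index. *)
Definition coordinate x (k : nat) : K := oapp (x 0) 0 (insub k : option 'I_N).

Definition pointwise_structure (E : nat -> nat -> pexpr) (i j : 'I_N) x : K :=
  peval (coordinate x) (E i j).

Lemma coordinate0 : coordinate 0 =1 fun=> 0.
Proof.
by move=> k; rewrite /coordinate; case: insubP => //= u _ _; rewrite mxE.
Qed.

Lemma coordinate_curve i j t s : i != j ->
  coordinate (curve i j t s) =1 curve_point i j t s.
Proof.
move=> ij k; rewrite /coordinate /curve_point.
case: insubP => [u _ <-|kN] /=; first by rewrite curve_entry.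
by rewrite -leqNgt in kN; rewrite !gtn_eqF // (leq_trans _ kN).
Qed.

Lemma is_derive_coordinate (k : nat) x (l : 'I_N) :
  is_derive x (axis K l) (coordinate^~ k) (k == l)%:R.
Proof.
have h0 : (fun h : K => h^-1 *: (((coordinate^~ k) \o shift x) (h *: axis K l)
    - coordinate x k)) @ 0^' --> ((k == l)%:R : K).
  apply: cvg_near_cst; near=> h.
  have h_neq0 : h != 0 by near: h; exact: nbhs_dnbhs_neq.
  rewrite /= /coordinate; case: insubP => [u _ <-|kN] /=.
    rewrite !mxE eqxx /= addrK /GRing.scale /= mulrA mulVf // mul1r.
    by rewrite val_eqE.
  have -> : (k == l) = false by apply: contraNF kN => /eqP ->; apply: ltn_ord.
  by rewrite subrr scaler0.
by split; [apply/cvg_ex; eexists; exact: h0 | exact: cvg_lim h0].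
Unshelve. all: by end_near. Qed.

Lemma is_derive_peval E x (l : 'I_N) :
  is_derive x (axis K l) (fun y => peval (coordinate y) E)
    (peval (coordinate x) (pderiv l E)).
Proof.
elim: E => [n|k|E IHE F IHF|E IHE F IHF|E IHE] /=.
- exact: is_derive_cst.
- exact: is_derive_coordinate.
- exact: is_deriveD.
- have h := is_deriveM IHE IHF; apply: (is_derive_eq h).
  by rewrite addrC /GRing.scale /= [X in X + _]mulrC.
- exact: is_deriveN.
Qed.

Lemma pd_peval E (l : 'I_N) :
  pd (fun y => peval (coordinate y) E) l = fun y => peval (coordinate y) (pderiv l E).
Proof.
by apply/funext => x; rewrite /pd; have [_ ->] := is_derive_peval E x l.
Qed.

Lemma continuous_coordinate k : continuous (fun y => coordinate y k).
Proof.
rewrite /coordinate; case: insub => [u|] /=; last exact: cst_continuous.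
exact: coord_continuous.
Qed.

Lemma continuous_peval E : continuous (fun y => peval (coordinate y) E).
Proof.
elim: E => [n|k|E IHE F IHF|E IHE F IHF|E IHE] x /=.
- exact: cst_continuous.
- exact: continuous_coordinate.
- exact: (cvgD (IHE x) (IHF x)).
- exact: (cvgM (IHE x) (IHF x)).
- exact: (cvgN (IHE x)).
Qed.

Lemma linear_partE E (i j k : 'I_N) :
  linear_part (pointwise_structure E) i j k = peval (fun=> 0) (pderiv k (E i j)).
Proof.
rewrite /linear_part /pointwise_structure pd_peval.
exact/eq_peval/coordinate0.
Qed.

Lemma pointwise_structure_poisson U : pjacobi N (antisymmetrize U) ->
  poisson_near0 (pointwise_structure (antisymmetrize U)).
Proof.
move=> J; apply/near0_rowP; exists 1 => // x _; split=> [i j|i j k].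
  by rewrite /pointwise_structure peval_antisymmetrize.
rewrite -[RHS](J _ (coordinate x) i j k); apply: eq_bigr => l _.
by rewrite /pointwise_structure !pd_peval.
Qed.

End PointwisePolynomials.

Lemma pointwise_linearizing_at (K : numFieldType) n E
    (phi : 'I_n.+1 -> 'rV[K]_n.+1 -> K) x z :
  (forall i j, \sum_(k < n.+1) \sum_(l < n.+1) pointwise_structure E k l x
      * (pd (phi i) k x * pd (phi j) l x)
    = \sum_(k < n.+1) linear_part (pointwise_structure E) i j k * phi k x) ->
  coordinate x =1 z ->
  linearizing_at n.+1 E z (fun i k => pd (phi (inord i)) (inord k) x)
    (fun k => phi (inord k) x).
Proof.
move=> H xz i j iN jN; have := H (inord i) (inord j) => {H}.
rewrite /pointwise_structure.
under eq_bigr => k _ do under eq_bigr => l _ do rewrite (eq_peval _ xz).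
under [RHS]eq_bigr => k _ do rewrite linear_partE !inordK //.
move=> e; under eq_bigr => k _ do under eq_bigr => l _ do rewrite !inord_val.
by rewrite e; apply: eq_bigr => k _; rewrite inord_val.
Qed.

Section PointwiseNonlinearizable.
Variable K : numFieldType.

Let dnbhs_cvg_unique (f : K -> K) (a b : K) :
  f @ 0^' --> a -> f @ 0^' --> b -> a = b.
Proof. exact: norm_cvg_unique. Qed.

Lemma e3_not_linearizable (C : ('rV[K]_6 -> K) -> Prop) :
  (forall f, C f -> C1_at0 f) ->
  ~ linearizable C (pointwise_structure e3_poisson).
Proof.
move=> CC1 [phi [[phiC phi0 phiU] phi_lin]]; move: phiU; apply/negP.
apply: e3_jacobian_nonunit.
suff h (m : 'I_3) : pd (phi (inord 3)) (inord m) 0 = 0 /\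
    pd (phi (inord 3)) (inord m.+3) 0 = 0.
  case=> k hk; rewrite mxE.
  have [k3|k3] := ltnP k 3.
    rewrite (_ : Ordinal hk = inord k); first exact: (h (Ordinal k3)).1.
    by apply: val_inj; rewrite /= inordK.
  have k3' : (k - 3 < 3)%N by rewrite ltn_subLR.
  have e : (k - 3).+3 = k by rewrite -[LHS]addn3 subnK.
  rewrite (_ : Ordinal hk = inord (k - 3).+3); first exact: (h (Ordinal k3')).2.
  by apply: val_inj; rewrite /= e inordK.
case: m => m m3 /=.
have m6 : (m < 6)%N by apply: leq_trans m3 _.
pose i : 'I_6 := inord m; pose j : 'I_6 := inord m.+3.
have ij : i != j by rewrite -val_eqE /= !inordK // ltn_eqF // -addn3 -ltn_subLR // subnn.
have cE (t s : K) : coordinate (curve i j t s) =1 curve_point m m.+3 t s.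
  by move=> k; rewrite coordinate_curve // /curve_point !inordK.
have Ya : \forall t \near (0 : K)^', phi (inord 3) (t *: axis K i) = 0.
  apply: filterS (near0_axis i phi_lin) => t tlin; apply/eqP; rewrite -sqrf_eq0.
  apply/eqP/(@e3_curve K _ (fun k => phi (inord k) (t *: axis K i)) t 0 m m3).
    by rewrite expr0n mulr0.
  apply: (pointwise_linearizing_at tlin) => k; rewrite mul0r -cE.
  by rewrite /curve scale0r addr0.
have Yc : \forall t \near (0 : K)^', phi (inord 3) (curve i j t (t ^+ 3)) = 0.
  apply: filterS (near0_curve ij (@cvg_expr0 K 2) phi_lin) => t tlin.
  apply/eqP; rewrite -sqrf_eq0.
  apply/eqP/(@e3_curve K _ (fun k => phi (inord k) (curve i j t (t ^+ 3)))
    t (t ^+ 2) m m3); first exact: expr2.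
  by apply: (pointwise_linearizing_at tlin) => k; rewrite -exprSr cE.
have C1 := CC1 _ (phiC (inord 3)).
split; first exact: pd_axis0 (phi0 _) Ya.
have q := cvg_curve_quotient (j := j) C1 Ya.
apply: dnbhs_cvg_unique q _; apply: cvg_near_cst.
by apply: filterS Yc => t ->; rewrite mul0r.
Qed.

Lemma saff2_not_linearizable (C : ('rV[K]_5 -> K) -> Prop) :
  (forall f, C f -> C1_at0 f) ->
  ~ linearizable C (pointwise_structure saff2_poisson).
Proof.
move=> CC1 [phi [[phiC phi0 phiU] phi_lin]]; move: phiU; apply/negP.
pose J x r k : K := pd (phi (inord r)) (inord k) x.
pose Y x k : K := phi (inord k) x.
pose e : 'I_5 := inord 1; pose f : 'I_5 := inord 2.
have ef : e != f by rewrite -val_eqE /= !inordK.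
have fe : f != e by rewrite eq_sym.
have cE (t s : K) : coordinate (curve e f t s) =1 curve_point 1 2 t s.
  by move=> k; rewrite coordinate_curve // /curve_point !inordK.
have core t s x : curve e f t s = x ->
    (forall i j, \sum_(k < 5) \sum_(l < 5) pointwise_structure saff2_poisson k l x
      * (pd (phi i) k x * pd (phi j) l x)
    = \sum_(k < 5) linear_part (pointwise_structure saff2_poisson) i j k * phi k x) ->
    [/\ Y x 3%N ^+ 2 = - bivector_minors (J x) t s [:: 0; 1; 3; 4]%N,
      Y x 4%N ^+ 2 = - bivector_minors (J x) t s [:: 0; 2; 3; 4]%N &
      Y x 3%N * Y x 4%N = bivector_minors (J x) t s [:: 1; 2; 3; 4]%N].
  move=> <- xlin; have L := pointwise_linearizing_at xlin (cE t s).
  exact: saff2_curve L.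
have zero_minors x t s r : t * s = 0 -> bivector_minors (J x) t s r = 0.
  move=> ts; rewrite /bivector_minors; set a := minor _ _ _; set b := minor _ _ _.
  have -> : 8 * t ^+ 2 * s * a - 8 * t * s ^+ 2 * b
    = t * s * (8 * t * a - 8 * s * b) by ring.
  by rewrite ts mul0r.
have C1 k := CC1 _ (phiC k).
have Ye k : (2 < k < 5)%N -> \forall t \near (0 : K)^', phi (inord k) (t *: axis K e) = 0.
  move=> k35; apply: filterS (near0_axis e phi_lin) => t tlin.
  have [|+ + _] := core t 0 _ _ tlin; first by rewrite /curve scale0r addr0.
  rewrite !zero_minors ?mulr0 // oppr0 => /eqP; rewrite sqrf_eq0 => /eqP Y3.
  move=> /eqP; rewrite sqrf_eq0 => /eqP Y4.
  by case: k k35 => [|[|[|[|[|k]]]]].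
have Yf k : (2 < k < 5)%N -> \forall t \near (0 : K)^', phi (inord k) (t *: axis K f) = 0.
  move=> k35; apply: filterS (near0_axis f phi_lin) => t tlin.
  have [|+ + _] := core 0 t _ _ tlin; first by rewrite /curve scale0r add0r.
  rewrite !zero_minors ?mul0r // oppr0 => /eqP; rewrite sqrf_eq0 => /eqP Y3.
  move=> /eqP; rewrite sqrf_eq0 => /eqP Y4.
  by case: k k35 => [|[|[|[|[|k]]]]].
pose c (t : K) := curve e f t (t ^+ 3).
have minor_cvg r cols : (fun t : K => minor r cols (J (c t))) @ 0^' --> minor r cols (J 0).
  by apply: cvg_ndet => i j; apply: cvg_curve_pd.
have id0 : (fun t : K => t) @ 0^' --> (0 : K) by move=> A /nbhs_dnbhs.
(* The sign [sg] unifies the three identities, for -Y_3^2, -Y_4^2 and Y_3 Y_4. *)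
have minor0 r k l (sg : K) : (2 < k < 5)%N -> (2 < l < 5)%N -> sg ^+ 2 = 1 ->
   (\forall t \near (0 : K)^', Y (c t) k * Y (c t) l
      = sg * bivector_minors (J (c t)) t (t ^+ 3) r) ->
   minor r [:: 0; 1; 3; 4]%N (J 0) = 0.
  move=> k35 l35 sg2 YYE.
  have qk := cvg_curve_quotient (j := f) (C1 _) (Ye k k35).
  have ql := cvg_curve_quotient (j := f) (C1 _) (Ye l l35).
  (* The Pfaffian identity sg Y_k Y_l = 8 t^5 minor - 8 t^7 minor', solved for the first minor. The
     quotients Y / t^3 converge, so both terms of [D] tend to 0. *)
  pose D (t : K) := t ^+ 2 * minor r [:: 0; 2; 3; 4]%N (J (c t))
    + (sg / 8) * (t * ((Y (c t) k / t ^+ 3) * (Y (c t) l / t ^+ 3))).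
  have D0 : D @ 0^' --> (0 : K).
    have := cvgD (cvgM (@cvg_expr0 K 1) (minor_cvg r [:: 0; 2; 3; 4]%N))
      (cvgM (cvg_cst (sg / 8)) (cvgM id0 (cvgM qk ql))).
    by rewrite !mul0r mulr0 addr0; apply.
  apply: dnbhs_cvg_unique (minor_cvg r [:: 0; 1; 3; 4]%N) _.
  apply: cvg_trans D0; apply: near_eq_cvg; near=> t.
  have t0 : t != 0 by near: t; exact: nbhs_dnbhs_neq.
  have YY : Y (c t) k * Y (c t) l = sg * bivector_minors (J (c t)) t (t ^+ 3) r.
    by near: t.
  rewrite /D; set a := minor _ _ _; set b := minor _ _ _.
  have -> : (Y (c t) k / t ^+ 3) * (Y (c t) l / t ^+ 3)
    = (Y (c t) k * Y (c t) l) / t ^+ 6 by field.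
  rewrite YY /bivector_minors -/a -/b.
  have -> : sg / 8 * (t * (sg * (8 * t ^+ 2 * t ^+ 3 * b - 8 * t * (t ^+ 3) ^+ 2 * a) / t ^+ 6))
     = sg ^+ 2 * (b - t ^+ 2 * a) by field.
  by rewrite sg2; ring.
have c_lin := near0_curve ef (@cvg_expr0 K 2) phi_lin.
have Ue : (fun i j => (\matrix_(i < 5, k < 5) pd (phi i) k 0) (inord i) (inord j))
  = J 0.
  by apply/funext => p; apply/funext => q; rewrite mxE.
apply: saff2_jacobian_nonunit; rewrite ?Ue.
- by rewrite mxE; apply: pd_axis0 (C1 _) (phi0 _) (Yf 3%N _).
- by rewrite mxE; apply: pd_axis0 (C1 _) (phi0 _) (Yf 4%N _).
- apply: (minor0 _ 3%N 3%N (-1)); rewrite ?sqrrN ?expr1n //.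
  by apply: filterS c_lin => t /(core t (t ^+ 3) _ erefl)[Y3 _ _]; rewrite mulN1r -Y3.
- apply: (minor0 _ 4%N 4%N (-1)); rewrite ?sqrrN ?expr1n //.
  by apply: filterS c_lin => t /(core t (t ^+ 3) _ erefl)[_ Y4 _]; rewrite mulN1r -Y4.
- apply: (minor0 _ 3%N 4%N 1); rewrite ?expr1n //.
  by apply: filterS c_lin => t /(core t (t ^+ 3) _ erefl)[_ _ Y34]; rewrite mul1r -Y34.
Unshelve. all: by end_near. Qed.

End PointwiseNonlinearizable.

(** * Smooth and analytic germs *)

Section Smooth.
Variables (R : realType) (N : nat).

(** The mean value theorem on the segment from x to x + s e_k turns the increment into s times a
    partial derivative near 0, and that derivative is continuous at 0. *)
Lemma smooth_C1_at0 (f : 'rV[R]_N -> R) : smooth_near0 f -> C1_at0 f.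
Proof.
move=> [U [Uo U0 fU]] k e e0.
have : \forall x \near (0 : 'rV[R]_N), U x by exact: open_nbhs_nbhs.
move=> /near0_rowP[d1 d10 dU].
have [/= /cvgrPdistC_le/(_ _ e0) /near0_rowP[d2 d20 dpd] _] := fU [:: k] 0 U0.
pose d := Num.min d1 d2.
have d0 : 0 < d by rewrite lt_min d10.
have {}dU (x : 'rV[R]_N) : (forall i, `|x 0 i| < d) -> U x.
  by move=> xd; apply: dU => i; have := xd i; rewrite lt_min => /andP[].
have {}dpd (x : 'rV[R]_N) : (forall i, `|x 0 i| < d) -> `|pd f k x - pd f k 0| <= e.
  by move=> xd; apply: dpd => i; have := xd i; rewrite lt_min => /andP[].
have fder (x : 'rV[R]_N) (u : R) : (forall i, `|(x + u *: axis R k) 0 i| < d) ->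
    is_derive u 1 (fun v => f (x + v *: axis R k)) (pd f k (x + u *: axis R k)).
  move=> /dU Ux; have [_ /(_ k)] := fU [::] _ Ux => /= /derivableP[fx fE].
  have E : (fun h : R => h^-1 *: (((fun v => f (x + v *: axis R k)) \o shift u) (h *: 1)
       - f (x + u *: axis R k)))
     = (fun h : R => h^-1 *: ((f \o shift (x + u *: axis R k)) (h *: axis R k)
       - f (x + u *: axis R k))).
    apply/funext => h /=; congr (_ *: (f _ - _)).
    by rewrite -[h *: 1]/(h * 1) mulr1 scalerDl addrCA.
  by split; rewrite ?/derivable ?/derive E.
have pos (x : 'rV[R]_N) (s : R) : 0 < s ->
   (forall u i, 0 <= u <= s -> `|(x + u *: axis R k) 0 i| < d) ->
   `|f (x + s *: axis R k) - f x - s * pd f k 0| <= e * s.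
  move=> s0 xs.
  have [c|c|c] := @MVT R (fun v => f (x + v *: axis R k))
    (fun u => pd f k (x + u *: axis R k)) 0 s s0.
  - rewrite in_itv /= => /andP[c0 cs]; apply: fder => i.
    by apply: xs; rewrite !ltW.
  - apply: derivable_within_continuous => u; rewrite in_itv /= => us.
    by have [] : is_derive u 1 _ _ := fder x u (fun i => xs u i us).
  rewrite in_itv /= => /andP[c0 cs].
  rewrite subr0 scale0r addr0 => ->; rewrite mulrC -mulrBr normrM (gtr0_norm s0) mulrC.
  by rewrite ler_pM2r //; apply: dpd => i; apply: xs; rewrite !ltW.
exists (d / 2); first by rewrite divr_gt0.
have bound (x : 'rV[R]_N) u i : `|x 0 i| < d / 2 -> `|u| < d / 2 ->
    `|(x + u *: axis R k) 0 i| < d.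
  move=> xd ud; rewrite !mxE eqxx /= [X in _ < X]splitr.
  apply: le_lt_trans (ler_normD _ _) _; apply: ltr_leD => //.
  by case: (i == k); rewrite ?mulr1 ?mulr0 ?normr0 ltW // divr_gt0.
move=> x xd; split.
  apply: dpd => i; apply: lt_le_trans (xd i) _.
  by clear -d0; move: d0; generalize d => y y0; lra.
move=> s sd; have [s0|s0|<-] := ltgtP 0 s.
- rewrite (gtr0_norm s0); apply: pos => // u i /andP[u0 us]; apply: bound => //.
  by rewrite ger0_norm //; apply: le_lt_trans us _; rewrite -(gtr0_norm s0).
(* For s < 0 the segment is traversed from its other end, x + s e_k. *)
- rewrite (ltr0_norm s0).
  have -> : f (x + s *: axis R k) - f x - s * pd f k 0
    = - (f x - f (x + s *: axis R k) - (- s) * pd f k 0) by ring.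
  have xE : x + s *: axis R k + (- s) *: axis R k = x by rewrite scaleNr addrK.
  rewrite normrN -{1}xE; apply: pos => [|u i]; first by rewrite oppr_gt0.
  case/andP=> u0 us; rewrite -addrA -scalerDl; apply: bound => //.
  rewrite ler0_norm; last by lra.
  by apply: le_lt_trans sd; rewrite (ltr0_norm s0); lra.
- by rewrite scale0r addr0 subrr mul0r subrr normr0 mulr0.
Qed.

Lemma smooth_peval (E : pexpr) : smooth_near0 (fun x : 'rV[R]_N => peval (coordinate x) E).
Proof.
exists setT; split => // [|s x _]; first exact: openT.
have [F ->] : exists F, iter_pd (fun x : 'rV[R]_N => peval (coordinate x) E) s
    = (fun x : 'rV[R]_N => peval (coordinate x) F).
  elim: s E => [|k s IH] E; first by exists E.
  by have [F FE] := IH (pderiv k E); exists F; rewrite /= pd_peval.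
split; first exact: continuous_peval.
by move=> k; have [] := is_derive_peval F x k.
Qed.

End Smooth.

(** * Strict differentiability of convergent power series *)

Section Analytic.
Variables (K : numFieldType) (N : nat).
Implicit Types (x y h p : 'rV[K]_N) (b : multiindex N).

Lemma cvg_dist_le (T : Type) (F : set_system T) {FF : ProperFilter F}
    (u : T -> K) (l c B : K) :
  u @ F --> l -> (\forall t \near F, `|u t - c| <= B) -> `|l - c| <= B.
Proof.
move=> /cvgrPdist_le ul uB; apply/ler_addgt0Pr => e e0.
near F => t; rewrite -(subrK (u t) l) -addrA addrC.
apply: le_trans (ler_normD _ _) _; apply: lerD; near: t => //.
exact: ul.
Unshelve. all: by end_near. Qed.

(** The inverse of the sum of the inverses is positive and below each term, and needs no total order
    on K. *)
Lemma lower_bound3 (a b c : K) : 0 < a -> 0 < b -> 0 < c ->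
  exists d, [/\ 0 < d, d <= a, d <= b & d <= c].
Proof.
move=> a0 b0 c0; exists (a^-1 + b^-1 + c^-1)^-1.
have s0 : 0 < a^-1 + b^-1 + c^-1 by rewrite !addr_gt0 ?invr_gt0.
have le z : 0 < z -> z^-1 <= a^-1 + b^-1 + c^-1 -> (a^-1 + b^-1 + c^-1)^-1 <= z.
  by move=> z0 h; rewrite -[leRHS]invrK lef_pV2 ?posrE ?invr_gt0.
have [a1 b1 c1] : [/\ 0 <= a^-1, 0 <= b^-1 & 0 <= c^-1].
  by rewrite !invr_ge0 !ltW.
split; first by rewrite invr_gt0.
- by apply: le => //; rewrite -addrA lerDl addr_ge0.
- by apply: le => //; rewrite -addrA addrCA lerDl addr_ge0.
- by apply: le => //; rewrite lerDr addr_ge0.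
Qed.

Definition degree b : nat := (\sum_(i < N) b i)%N.

Lemma norm_subXX_le (y z rho : K) n : `|y| <= rho -> `|z| <= rho ->
  `|y ^+ n - z ^+ n| <= `|y - z| * (n%:R * rho ^+ n.-1).
Proof.
move=> yr zr; have r0 : 0 <= rho by apply: le_trans yr.
rewrite subrXX normrM ler_wpM2l //; apply: le_trans (ler_norm_sum _ _ _) _.
apply: (@le_trans _ _ (\sum_(i < n) rho ^+ n.-1)).
  apply: ler_sum => i _; rewrite normrM !normrX.
  have -> : n.-1 = (n.-1 - i + i)%N.
    by rewrite subnK // -ltnS (leq_trans (ltn_ord i)) // leqSpred.
  by rewrite addnK exprD ler_pM ?exprn_ge0 // lerXn2r ?nnegrE.
by rewrite sumr_const card_ord mulr_natl.
Qed.

(* 4 / r^2 comes from d 2^(2 - d) <= 4, applied to the degree d >= 2. *)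
Lemma monomial_step_le b k x (s rho r : K) : 0 < r -> rho <= r / 2 ->
  (forall i, `|x 0 i| <= rho) -> `|x 0 k + s| <= rho ->
  `|monomial b (x + s *: axis K k) - monomial b x - s * (b == mi1 k)%:R|
    <= `|s| * rho * (4 / r ^+ 2) * r ^+ degree b.
Proof.
move=> r0 rhor xr xsr; have r_ge0 := ltW r0; have rho0 : 0 <= rho by apply: le_trans xsr.
pose P := \prod_(i < N | i != k) x 0 i ^+ b i.
pose e := (\sum_(i < N | i != k) b i)%N.
have monx : monomial b x = x 0 k ^+ b k * P by rewrite /monomial (bigD1 k).
have mony : monomial b (x + s *: axis K k) = (x 0 k + s) ^+ b k * P.
  rewrite /monomial (bigD1 k) //= !mxE !eqxx mulr1; congr (_ * _).
  by apply: eq_bigr => i ik; rewrite !mxE (negPf ik) andbF mulr0 addr0.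
have degE : degree b = (b k + e)%N by rewrite /degree (bigD1 k).
have Pe : `|P| <= rho ^+ e.
  rewrite /P /e normr_prod expr_sum ler_prod // => i _.
  by rewrite normr_ge0 normrX /=; apply: lerXn2r; rewrite ?nnegrE ?xr.
have rhs0 : 0 <= `|s| * rho * (4 / r ^+ 2) * r ^+ degree b.
  by rewrite !mulr_ge0 ?invr_ge0 ?exprn_ge0.
rewrite mony monx -mulrBl; have [bk|bk] := eqVneq b (mi1 k).
  have -> : P = 1.
    by apply: big1 => i ik; rewrite bk ffunE (negPf ik).
  have -> : ((x 0 k + s) ^+ b k - x 0 k ^+ b k) * 1 - s * true%:R = 0.
    by rewrite bk ffunE eqxx !expr1 -[true%:R]/(1 : K); ring.
  by rewrite normr0.
rewrite mulr0 subr0; case bkE: (b k) => [|c].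
  by rewrite !expr0 subrr mul0r normr0.
(* Here b contains z_k without being z_k itself, so its degree c + e + 1 is at least 2; this leaves
   the spare factor rho. *)
have ce : (0 < c + e)%N.
  rewrite lt0n addn_eq0; apply: contra bk => /andP[/eqP c0 e0].
  apply/eqP/ffunP => i; rewrite ffunE; have [->|ik] := eqVneq i k.
    by rewrite bkE c0.
  by move: e0; rewrite sum_nat_eq0 => /forallP/(_ i)/implyP/(_ ik)/eqP.
rewrite normrM; apply: (@le_trans _ _ (`|s| * (c.+1%:R * rho ^+ c) * rho ^+ e)).
  rewrite ler_pM //; have := norm_subXX_le c.+1 xsr (xr k).
  by rewrite [_ + s]addrC addrK.
have [d dE] : exists d, (c + e = d.+1)%N by exists (c + e).-1; rewrite prednK.
have r_neq0 : r != 0 by rewrite gt_eqF.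
have -> : `|s| * (c.+1%:R * rho ^+ c) * rho ^+ e
    = `|s| * rho * (c.+1%:R * rho ^+ d).
  by rewrite -!mulrA -exprD dE exprS; ring.
have -> : `|s| * rho * (4 / r ^+ 2) * r ^+ degree b = `|s| * rho * (4 * r ^+ d).
  by rewrite degE bkE addSn dE !exprS; field.
rewrite ler_wpM2l ?mulr_ge0 //.
apply: (@le_trans _ _ ((4 * 2 ^+ d) * (r / 2) ^+ d)).
  rewrite ler_pM ?exprn_ge0 //; last by rewrite lerXn2r ?nnegrE // divr_ge0.
  have -> : 4 * 2 ^+ d = (2 ^ d.+2)%N%:R :> K by rewrite natrX !exprS; ring.
  rewrite ler_nat; apply: leq_trans (ltnW (ltn_expl d.+2 (isT : (1 < 2)%N))).
  by rewrite ltnS -dE leq_addr.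
by rewrite expr_div_n -mulrA [2 ^+ d * _]mulrCA mulfV ?mulr1.
Qed.

(** Termwise comparison with the series at (r, ..., r), r = d / 2. Constant and linear terms are
    matched exactly, and every other term changes by at most a multiple of |s| rho times its size
    there. The bound is uniform in the base point x. *)
Lemma analytic_strict f p : analytic_at f p ->
  exists (A : 'I_N -> K) (r C : K), [/\ 0 < r, 0 < C & forall x s k rho,
    rho <= r -> (forall i, `|x 0 i| <= rho) -> `|x 0 k + s| <= rho ->
    `|f (p + x + s *: axis K k) - f (p + x) - s * A k| <= C * rho * `|s|].
Proof.
case=> a /near0_rowP[d d0 dP]; exists (fun k => a (mi1 k)).
pose r := d / 2; have r0 : 0 < r by rewrite divr_gt0.
have rd : r < d by rewrite ltr_pdivrMr // ltr_pMr // (ltr_nat K 1 2).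
have [M0 M0P] : exists M : K, forall n : nat,
    \sum_(b : {ffun 'I_N -> 'I_n})
      `|a (box_mi b) * monomial (box_mi b) (const_mx r : 'rV[K]_N)| <= M.
  have [i|[M MP] _] := dP (const_mx r); first by rewrite mxE gtr0_norm.
  by exists M.
pose M := M0 + 1.
have M00 : 0 <= M0 by apply: le_trans (M0P 0%N); apply: sumr_ge0.
have M_gt0 : 0 < M by rewrite ltr_wpDl.
have MP n : \sum_(b : {ffun 'I_N -> 'I_n}) `|a (box_mi b)| * r ^+ degree (box_mi b) <= M.
  apply: le_trans (_ : M0 <= M); last by rewrite lerDl.
  apply: le_trans (M0P n); apply: ler_sum => b _; rewrite normrM ler_wpM2l //.
  rewrite /monomial /degree expr_sum -[leLHS]ger0_norm; last first.
    by apply: prodr_ge0 => i _; rewrite exprn_ge0 // ltW.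
  by under [X in _ <= `|X|]eq_bigr do rewrite mxE.
exists (r / 2), (4 / r ^+ 2 * M); split.
- by rewrite divr_gt0.
- by rewrite mulr_gt0 ?divr_gt0 ?exprn_gt0.
move=> x s k rho rhor xr xsr.
have rho0 : 0 <= rho by apply: le_trans xsr.
have rhod : rho < d.
  apply: le_lt_trans rd; apply: le_trans rhor _.
  by rewrite ler_pdivrMr // ler_pMr // (ler_nat K 1 2).
have yr i : `|(x + s *: axis K k) 0 i| <= rho.
  by rewrite !mxE eqxx /=; have [->|_] := eqVneq i k; rewrite ?mulr1 // mulr0 addr0.
have [_ cx] := dP x (fun i => le_lt_trans (xr i) rhod).
have [_ cy] := dP _ (fun i => le_lt_trans (yr i) rhod).
rewrite -(addrA p); apply: (cvg_dist_le (cvgB cy cx)).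
(* Boxes of side at least 2 contain the unit multi-index of z_k. *)
exists 2%N => // n /= n2.
have mi1n i : (mi1 k i < n)%N by rewrite ffunE; apply: leq_trans n2; case: (i == k).
have -> : s * a (mi1 k) = \sum_(b : {ffun 'I_N -> 'I_n})
    a (box_mi b) * (s * (box_mi b == mi1 k)%:R).
  rewrite mulrC -(box_sum_pick (fun b => a b * s) mi1n) big_mkcond.
  by apply: eq_bigr => b _; case: (box_mi b == _); rewrite ?mulr1 ?mulr0.
rewrite addrfctE opprfctE /= -!sumrB; apply: le_trans (ler_norm_sum _ _ _) _.
apply: (@le_trans _ _ (\sum_(b : {ffun 'I_N -> 'I_n})
   (`|s| * rho * (4 / r ^+ 2)) * (`|a (box_mi b)| * r ^+ degree (box_mi b)))).
  apply: ler_sum => b _; rewrite -!mulrBr normrM mulrCA ler_wpM2l //.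
  exact: monomial_step_le.
rewrite -mulr_sumr.
have -> : 4 / r ^+ 2 * M * rho * `|s| = `|s| * rho * (4 / r ^+ 2) * M by ring.
by rewrite ler_wpM2l // !mulr_ge0 ?invr_ge0 ?exprn_ge0 // ltW.
Qed.

End Analytic.

Section AnalyticGerms.
Variables (K : numFieldType) (N : nat).
Implicit Types (x h p : 'rV[K]_N) (f : 'rV[K]_N -> K).

(** At x = 0 with rho = |s|, the estimate bounds the error of the difference quotient by C |s|. *)
Lemma strict_is_derive f p (A : 'I_N -> K) (r C : K) k : 0 < r -> 0 < C ->
  (forall x s k rho,
    rho <= r -> (forall i, `|x 0 i| <= rho) -> `|x 0 k + s| <= rho ->
    `|f (p + x + s *: axis K k) - f (p + x) - s * A k| <= C * rho * `|s|) ->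
  is_derive p (axis K k) f (A k).
Proof.
move=> r0 C0 fA.
have q : (fun h : K => h^-1 *: ((f \o shift p) (h *: axis K k) - f p)) @ 0^'
    --> A k.
  apply/cvgrPdistC_le => e e0; near=> s.
  have s0 : s != 0 by near: s; exact: nbhs_dnbhs_neq.
  rewrite -(ler_pM2l (_ : 0 < `|s|)) ?normr_gt0 // -normrM.
  have -> : s * (s^-1 *: ((f \o shift p) (s *: axis K k) - f p) - A k)
    = f (p + 0 + s *: axis K k) - f (p + 0) - s * A k.
    by rewrite mulrBr /GRing.scale /= mulVKf // addr0 [s *: _ + p]addrC.
  apply: le_trans (fA 0 s k `|s| _ _ _) _.
  - by near: s; exact: dnbhs0_le.
  - by move=> i; rewrite mxE normr0.
  - by rewrite mxE add0r.
  rewrite mulrC ler_wpM2l // mulrC -ler_pdivlMr //.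
  by near: s; apply: dnbhs0_le; rewrite divr_gt0.
by split; [apply/cvg_ex; exists (A k) | exact: (cvg_lim (@norm_hausdorff _ _) q)].
Unshelve. all: by end_near. Qed.

(** The strict estimate at 0 compares difference quotients at every nearby x with the derivative at
    0. Their limit exists by analyticity at x and inherits the bound, so the series need not be
    differentiated term by term. *)
Lemma analytic_C1_at0 f : analytic_near0 f -> C1_at0 f.
Proof.
move=> fan k e e0; have /near0_rowP[d0 d0_gt0 dan] := fan.
have der x : (forall i, `|x 0 i| < d0) -> exists A, is_derive x (axis K k) f A.
  move=> /dan/analytic_strict[A [r [C [r0 C0 fA]]]].
  by exists (A k); apply: strict_is_derive r0 C0 fA.
have /analytic_strict[A [r [C [r0 C0 fA]]]] : analytic_at f 0.
  by apply: dan => i; rewrite mxE normr0.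
have -> : pd f k 0 = A k by have [_] := strict_is_derive k r0 C0 fA.
have r2 : 0 < r / 2 by rewrite divr_gt0.
have eC : 0 < e / (2 * C) by rewrite divr_gt0 // mulr_gt0.
have [d [d_gt0 dd0 dr de]] := lower_bound3 d0_gt0 r2 eC.
have strict x s : (forall i, `|x 0 i| < d) -> `|s| < d ->
    `|f (x + s *: axis K k) - f x - s * A k| <= e * `|s|.
  (* The radius 2d bounds both |x_i| and |x_k + s|; it is at most r, and C . 2d <= e, by the choice
     of [d]. *)
  move=> xd sd; have := fA x s k (2 * d); rewrite !add0r => h.
  have dd : d <= 2 * d by rewrite mulr_natl mulr2n lerDl ltW.
  apply: le_trans (h _ _ _) _.
  - by rewrite mulrC -ler_pdivlMr.
  - by move=> i; rewrite (le_trans (ltW (xd i))).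
  - by rewrite (le_trans (ler_normD _ _)) // mulr_natl mulr2n lerD // ltW.
  have -> : C * (2 * d) = d * (2 * C) by ring.
  by rewrite ler_wpM2r // -ler_pdivlMr // mulr_gt0.
exists d => // x xd; split; last by move=> s; exact: strict.
have [|B [fx fB]] := der x; first by move=> i; apply: lt_le_trans (xd i) dd0.
rewrite /pd /derive; apply: (cvg_dist_le fx); near=> s.
have s0 : s != 0 by near: s; exact: nbhs_dnbhs_neq.
rewrite -(ler_pM2l (_ : 0 < `|s|)) ?normr_gt0 // -normrM.
have -> : s * (s^-1 *: ((f \o shift x) (s *: axis K k) - f x) - A k)
    = f (x + s *: axis K k) - f x - s * A k.
  by rewrite mulrBr /GRing.scale /= mulVKf // [s *: _ + x]addrC.
rewrite [leRHS]mulrC; apply: strict => //.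
by near: s; exact: dnbhs0_lt.
Unshelve. all: by end_near. Qed.

(** A polynomial as a list of terms in which exponents may repeat, so that expanding an expression
    at a new base point requires no normal form. *)
Definition monomial_sum (s : seq (K * multiindex N)) h : K :=
  \sum_(cb <- s) cb.1 * monomial cb.2 h.

Lemma monomialD (b c : multiindex N) h :
  monomial (miadd b c) h = monomial b h * monomial c h.
Proof.
by rewrite /monomial -big_split; apply: eq_bigr => i _; rewrite ffunE exprD.
Qed.

Lemma monomial0 h : monomial (mi0 N) h = 1.
Proof. by apply: big1 => i _; rewrite ffunE expr0. Qed.

Lemma monomial1 (k : 'I_N) h : monomial (mi1 k) h = h 0 k.
Proof.
rewrite /monomial (bigD1 k) //= ffunE eqxx expr1 big1 ?mulr1 // => i ik.
by rewrite ffunE (negPf ik) expr0.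
Qed.

Lemma peval_monomial_sum E p : exists s, forall h,
  peval (coordinate (p + h)) E = monomial_sum s h.
Proof.
elim: E => [n|k|E [s sE] F [t tF]|E [s sE] F [t tF]|E [s sE]] /=.
- exists [:: (n%:R, mi0 N)] => h.
  by rewrite /monomial_sum big_seq1 monomial0 mulr1.
- rewrite /coordinate; case: insub => [u|] /=; last first.
    by exists [::] => h; rewrite /monomial_sum big_nil.
  exists [:: (p 0 u, mi0 N); (1, mi1 u)] => h.
  rewrite /monomial_sum big_cons big_seq1 monomial0 monomial1 mulr1 mul1r.
  by rewrite mxE.
- by exists (s ++ t) => h; rewrite /monomial_sum big_cat /= sE tF.
- exists [seq (c.1 * d.1, miadd c.2 d.2) | c <- s, d <- t] => h.
  rewrite /monomial_sum big_allpairs_dep /= sE tF mulr_suml.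
  apply: eq_bigr => c _; rewrite mulr_sumr; apply: eq_bigr => d _.
  by rewrite monomialD mulrACA.
- exists [seq (- c.1, c.2) | c <- s] => h.
  rewrite /monomial_sum big_map sE -sumrN; apply: eq_bigr => c _.
  by rewrite mulNr.
Qed.

Lemma monomial_sum_analytic s f p : (forall h, f (p + h) = monomial_sum s h) ->
  analytic_at f p.
Proof.
move=> fs; pose a (m : multiindex N) := \sum_(cb <- s) (if cb.2 == m then cb.1 else 0).
exists a; apply/near0_rowP; exists 1 => // h _.
(* [F] is the norm for absolute convergence and the identity for the value of the sum. *)
have pick n (F : K -> K) (F0 : F 0 = 0) (cb : K * multiindex N) :
    \sum_(b : {ffun 'I_N -> 'I_n})
      F ((if cb.2 == box_mi b then cb.1 else 0) * monomial (box_mi b) h)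
    = if [forall i, cb.2 i < n]%N then F (cb.1 * monomial cb.2 h) else 0.
  transitivity (\sum_(b : {ffun 'I_N -> 'I_n} | box_mi b == cb.2)
      F (cb.1 * monomial (box_mi b) h)).
    rewrite [RHS]big_mkcond; apply: eq_bigr => b _; rewrite eq_sym.
    by case: (box_mi b == cb.2); rewrite ?mul0r.
  case: ifPn => [/forallP bn|bn].
    exact: (box_sum_pick (fun b => F (cb.1 * monomial b h)) bn).
  exact: (box_sum_pick0 (fun b => F (cb.1 * monomial b h)) bn).
split.
  exists (\sum_(cb <- s) `|cb.1 * monomial cb.2 h|) => n.
  apply: (@le_trans _ _ (\sum_(b : {ffun 'I_N -> 'I_n}) \sum_(cb <- s)
      `|(if cb.2 == box_mi b then cb.1 else 0) * monomial (box_mi b) h|)).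
    by apply: ler_sum => b _; rewrite mulr_suml; apply: ler_norm_sum.
  rewrite exchange_big /=; apply: ler_sum => cb _.
  by rewrite (pick n Num.norm) ?normr0 //; case: ifP.
(* Once the box side reaches [n0], which exceeds all exponents in the list, the partial sums are
   constant. *)
have [n0 n0P] : exists n0, forall cb, cb \in s -> forall i, (cb.2 i < n0)%N.
  elim: (s) => [|c t [n0 n0P]]; first by exists 0%N.
  exists (maxn n0 (\sum_i c.2 i).+1) => cb; rewrite inE => /predU1P[->|/n0P cn] i.
    by rewrite leq_max ltnS (bigD1 i) //= leq_addr orbT.
  by rewrite leq_max cn.
apply: cvg_near_cst; exists n0 => // n /= n0n; rewrite fs.
transitivity (\sum_(b : {ffun 'I_N -> 'I_n}) \sum_(cb <- s)
      (if cb.2 == box_mi b then cb.1 else 0) * monomial (box_mi b) h).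
  by apply: eq_bigr => b _; rewrite mulr_suml.
rewrite exchange_big /= /monomial_sum big_seq [RHS]big_seq.
apply: eq_bigr => cb cbs; rewrite (pick n id) // ifT //.
by apply/forallP => i; apply: leq_trans n0n; apply: n0P.
Qed.

Lemma analytic_peval (E : pexpr) :
  analytic_near0 (fun x : 'rV[K]_N => peval (coordinate x) E).
Proof.
apply/near0_rowP; exists 1 => // p _.
by have [s sE] := peval_monomial_sum E p; apply: monomial_sum_analytic sE.
Qed.

End AnalyticGerms.

(** * Degeneracy of saff(2) and e(3) in each category *)

Section Degeneracy.

Lemma degenerate_in_witness (K : numFieldType) (n : nat) (g : lieAlgebra K)
    (C : forall N, ('rV[K]_N -> K) -> Prop) U (E := antisymmetrize U) :
  (forall F, C n (fun x => peval (coordinate x) F)) ->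
  (forall i j : 'I_n, peval (fun=> 0 : K) (E i j) = 0) ->
  pjacobi n E ->
  structure_constants g (fun i j k : 'I_n => peval (fun=> 0) (pderiv k (E i j))) ->
  ~ linearizable (C n) (@pointwise_structure K n E) -> degenerate_in C g.
Proof.
move=> CE E0 EJ gE nlin; exists n, (pointwise_structure E); split => //.
- by move=> i j; exact: CE.
- exact: pointwise_structure_poisson.
- by move=> i j; rewrite /pointwise_structure (eq_peval _ (@coordinate0 _ _)).
- case: gE => e [eb ec]; exists e; split=> // i j; rewrite ec.
  by apply: eq_bigr => k _; rewrite linear_partE.
Qed.

Lemma formally_degenerate_witness (K : numFieldType) (n : nat) (g : lieAlgebra K)
    U (E := antisymmetrize U) :
  (forall i j : 'I_n, peval (fun=> 0 : K) (E i j) = 0) ->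
  pjacobi n E ->
  structure_constants g (fun i j k : 'I_n => peval (fun=> 0) (pderiv k (E i j))) ->
  ~ formally_linearizable (@formal_structure K n E) -> formally_degenerate g.
Proof.
move=> E0 EJ gE nlin; exists n, (formal_structure K E); split => //.
- exact: formal_structure_poisson.
- by move=> i j; rewrite /formal_structure peval_fps_coef0.
- case: gE => e [eb ec]; exists e; split=> // i j; rewrite ec.
  by apply: eq_bigr => k _; rewrite formal_linear_partE.
Qed.

Lemma saff2_poisson_vanish (K : numFieldType) (i j : 'I_5) :
  peval (fun=> 0 : K) (saff2_poisson i j) = 0.
Proof.
case: i j => i hi [j hj]; move: i j hi hj.
by do 2![case=> [|[|[|[|[|//]]]]]] => * /=; ring.
Qed.

Lemma e3_poisson_vanish (K : numFieldType) (i j : 'I_6) :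
  peval (fun=> 0 : K) (e3_poisson i j) = 0.
Proof.
case: i j => i hi [j hj]; move: i j hi hj.
by do 2![case=> [|[|[|[|[|[|//]]]]]]] => * /=; ring.
Qed.

Lemma saff2_formally_degenerate (K : numFieldType) :
  formally_degenerate (saff2 K).
Proof.
apply: formally_degenerate_witness (saff2_poisson_vanish K) saff2_jacobi
  (saff2_structure_constants K) _.
exact: saff2_not_formally_linearizable.
Qed.

Lemma saff2_analytically_degenerate (K : numFieldType) :
  analytically_degenerate (saff2 K).
Proof.
apply: degenerate_in_witness (saff2_poisson_vanish K) saff2_jacobi
  (saff2_structure_constants K) _ => [F|]; first exact: analytic_peval.
exact/saff2_not_linearizable/analytic_C1_at0.
Qed.

Lemma saff2_smoothly_degenerate (R : realType) : smoothly_degenerate (saff2 R).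
Proof.
apply: degenerate_in_witness (saff2_poisson_vanish R) saff2_jacobi
  (saff2_structure_constants R) _ => [F|]; first exact: smooth_peval.
exact/saff2_not_linearizable/smooth_C1_at0.
Qed.

Lemma e3_formally_degenerate (K : numFieldType) : formally_degenerate (e3 K).
Proof.
apply: formally_degenerate_witness (e3_poisson_vanish K) e3_jacobi
  (e3_structure_constants K) _.
exact: e3_not_formally_linearizable.
Qed.

Lemma e3_analytically_degenerate (K : numFieldType) :
  analytically_degenerate (e3 K).
Proof.
apply: degenerate_in_witness (e3_poisson_vanish K) e3_jacobi
  (e3_structure_constants K) _ => [F|]; first exact: analytic_peval.
exact/e3_not_linearizable/analytic_C1_at0.
Qed.

Lemma e3_smoothly_degenerate (R : realType) : smoothly_degenerate (e3 R).
Proof.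
apply: degenerate_in_witness (e3_poisson_vanish R) e3_jacobi
  (e3_structure_constants R) _ => [F|]; first exact: smooth_peval.
exact/e3_not_linearizable/smooth_C1_at0.
Qed.

End Degeneracy.

Theorem mainTheorem2 (R : realType) :
  [/\ formally_degenerate (saff2 R), analytically_degenerate (saff2 R) &
      smoothly_degenerate (saff2 R)] /\
  (formally_degenerate (saff2 R[i]) /\ analytically_degenerate (saff2 R[i])) /\
  [/\ formally_degenerate (e3 R), analytically_degenerate (e3 R) &
      smoothly_degenerate (e3 R)].
Proof.
do !split.
- exact: saff2_formally_degenerate.
- exact: saff2_analytically_degenerate.
- exact: saff2_smoothly_degenerate.
- exact: saff2_formally_degenerate.
- exact: saff2_analytically_degenerate.
- exact: e3_formally_degenerate.
- exact: e3_analytically_degenerate.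
- exact: e3_smoothly_degenerate.
Qed.
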